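(* Consider the Bass model on the homogeneous complete network in the limit $M\to\infty$, with promotional effects $p(s_p)=p_0+b_p\sqrt{s_p}$, $q(s_q)=q_0+b_q\sqrt{s_q}$ $(s_p,s_q\ge0)$, and with the profit rate $$\pi(\mathbf{s}(t))=e^{-\theta t}\Big(\gamma\frac{df}{dt}-\big((1-f)s_p(t)+f(1-f)s_q(t)\big)\Big).$$ Then the optimal promotion policy $\mathbf{s}^{\rm opt}=(s_p^{\rm opt},s_q^{\rm opt})$, i.e. the maximizer of $\Pi[\mathbf{s}(t)]=\int_0^T\pi(\mathbf{s}(t))\,dt$ over $\mathcal{S}^2$, is given by $$s_p^{\rm opt}(t)=\frac{b_p^2}{4}\big(\Psi(t)e^{\theta t}+\gamma\big)^2,\qquad s_q^{\rm opt}(t)=\frac{b_q^2}{b_p^2}s_p^{\rm opt}(t),$$ where $f(t)$ and $\Psi(t)$ solve (with $s_p=s_p^{\rm opt}$, $s_q=s_q^{\rm opt}$) the boundary-value problem $$\frac{df}{dt}=(1-f)\Big(p(s_p(t))+q(s_q(t))f\Big),\qquad f(0)=0,$$ $$\frac{d\Psi}{dt}=\big(\gamma e^{-\theta t}+\Psi\big)\Big(p(s_p(t))+q(s_q(t))(2f-1)\Big)-\Big(s_p(t)+(2f-1)s_q(t)\Big)e^{-\theta t},\qquad \Psi(T)=0.$$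
   Context: Bass model on the homogeneous complete network with $M$ nodes: all nodes are nonadopters at $t=0$; a nonadopter adopts at rate $p(s_p(t))+\frac{q(s_q(t))}{M-1}N(t)$, where $N(t)$ is the number of adopters; adopters remain adopters. As $M\to\infty$, the expected fraction of adopters converges (known result) to the solution $f(t)$ of $\frac{df}{dt}=(1-f)\big(p(s_p(t))+q(s_q(t))f\big)$, $f(0)=0$, and the optimal promotion problem is posed with this $f$. Here $s_p$ is the spending level on external promotion per nonadopter and $s_q$ the spending level on internal promotion per adopter–nonadopter interaction. The constants $p_0,q_0,b_p,b_q,\gamma$ are positive, $\theta\ge0$ is the discount rate (positive if $T=\infty$), $T\in(0,\infty]$ is the planning horizon (if $T=\infty$, the terminal condition is understood as $t\to\infty$), and $\mathcal{S}$ is the set of piecewise-continuous functions from $[0,T]$ to $[0,\infty)$. Identities for controls are understood up to changing the control at finitely many times. *)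

(* Defs.v *)
(** Optimal promotion in the compartmental (infinite-population) Bass model.
    Stdlib reals with Coquelicot. *)
From Stdlib Require Import Reals List.
From Coquelicot Require Import Coquelicot.
Open Scope R_scope.

(** The planning horizon [T] is an extended real; for [T = p_infty] the closed
    interval is [0, oo), since times are real numbers. *)
Definition in_horizon (T : Rbar) (t : R) : Prop :=
  0 <= t /\ Rbar_le (Finite t) T.

Definition inside_horizon (T : Rbar) (t : R) : Prop :=
  0 < t /\ Rbar_lt (Finite t) T.

(** Finitely many breakpoints over the whole horizon, and finite one-sided limits
    at every time of the horizon; no limit is required at [t -> oo].  Values
    outside the horizon are irrelevant. *)
Definition piecewise_continuous (T : Rbar) (s : R -> R) : Prop :=
  (exists breaks : list R,
     forall t, inside_horizon T t -> ~ In t breaks -> continuous s t) /\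
  (forall t, 0 <= t -> Rbar_lt (Finite t) T ->
     exists r : R, filterlim s (at_right t) (locally r)) /\
  (forall t, 0 < t -> Rbar_le (Finite t) T ->
     exists r : R, filterlim s (at_left t) (locally r)).

Definition admissible (T : Rbar) (s : R -> R) : Prop :=
  piecewise_continuous T s /\ (forall t, in_horizon T t -> 0 <= s t).

Definition equal_up_to_finite (T : Rbar) (u v : R -> R) : Prop :=
  exists exceptions : list R,
    forall t, in_horizon T t -> ~ In t exceptions -> u t = v t.

Definition adoption_speed (p q : R -> R) (sp sq f : R -> R) (t : R) : R :=
  (1 - f t) * (p (sp t) + q (sq t) * f t).

(** [f] is the expected fraction of adopters under the controls [sp], [sq].  As
    these may jump, the differential equation is imposed outside a finite set of
    times, together with continuity on the closed horizon. *)
Definition adoption (p q : R -> R) (T : Rbar) (sp sq f : R -> R) : Prop :=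
  continuous_on (in_horizon T) f /\
  f 0 = 0 /\
  exists exceptions : list R,
    forall t, inside_horizon T t -> ~ In t exceptions ->
      is_derive f t (adoption_speed p q sp sq f t).

Definition profit_rate (theta gamma : R) (sp sq f : R -> R) (t : R) : R :=
  exp (- theta * t) *
  (gamma * Derive f t - ((1 - f t) * sp t + f t * (1 - f t) * sq t)).

(** For [T = p_infty] the limit always exists in [Rbar] along admissible controls:
    the discounted revenue converges and the accumulated cost is nondecreasing.
    It is [m_infty] for policies of infinite cost. *)
Definition profit (theta gamma : R) (T : Rbar) (sp sq f : R -> R) : Rbar :=
  match T with
  | Finite T0 => Finite (RInt (profit_rate theta gamma sp sq f) 0 T0)
  | _ => Lim (fun t => RInt (profit_rate theta gamma sp sq f) 0 t) p_infty
  end.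

(** The state [f] is determined on the horizon by the controls, so quantifying
    over it only names the solution of the initial value problem. *)
Definition optimal_policy (p q : R -> R) (theta gamma : R) (T : Rbar)
    (sp sq : R -> R) : Prop :=
  admissible T sp /\ admissible T sq /\
  exists f, adoption p q T sp sq f /\
    forall sp' sq' f',
      admissible T sp' -> admissible T sq' -> adoption p q T sp' sq' f' ->
      Rbar_le (profit theta gamma T sp' sq' f') (profit theta gamma T sp sq f).

Definition promotion_effect (c b s : R) : R := c + b * sqrt s.

Definition costate_speed (p q : R -> R) (theta gamma : R)
    (sp sq f Psi : R -> R) (t : R) : R :=
  (gamma * exp (- theta * t) + Psi t) * (p (sp t) + q (sq t) * (2 * f t - 1))
  - (sp t + (2 * f t - 1) * sq t) * exp (- theta * t).

Definition vanishes_at_horizon (T : Rbar) (Psi : R -> R) : Prop :=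
  match T with
  | Finite T0 => Psi T0 = 0
  | _ => is_lim Psi p_infty 0
  end.

(** Classical solutions: both equations hold at every interior time, and [f] and
    [Psi] are continuous on the closed horizon, so that the boundary conditions
    are meaningful. *)
Definition boundary_value_problem (p q : R -> R) (theta gamma : R) (T : Rbar)
    (sp sq f Psi : R -> R) : Prop :=
  continuous_on (in_horizon T) f /\
  continuous_on (in_horizon T) Psi /\
  (forall t, inside_horizon T t ->
     is_derive f t (adoption_speed p q sp sq f t)) /\
  f 0 = 0 /\
  (forall t, inside_horizon T t ->
     is_derive Psi t (costate_speed p q theta gamma sp sq f Psi t)) /\
  vanishes_at_horizon T Psi.

(* Main.v *)
Require Import Defs.
From Stdlib Require Import Reals List Lra Classical ClassicalEpsilon FunctionalExtensionality.
From Coquelicot Require Import Coquelicot.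
Open Scope R_scope.

(** The first-order conditions are obtained by needle variations, the second-order error
    being explicit because the state equation is a Riccati equation.  Along a policy, put
    [delta = (1 - f) exp Q] with [Q' = q (1 - f)]; this is the sensitivity of [f] to its
    initial value.  Since [f exp (- Q)] is nondecreasing, [exp Q] is bounded away from [t = 0],
    so a needle of length [e] changes [f] by at most [K e (1 - f)] afterwards.  With
    [L = Psi + gamma exp (- theta t)], a solution of the costate equation, the change of the
    profit is the integral of a difference of Hamiltonians plus a term of second order
    in [e], whence the maximum principle.

    The costate is [L = (c - A) / delta], where [A] is an antiderivative of
    [delta exp (- theta t) (sp + (2 f - 1) sq + theta gamma)].  For [T = oo] the constant [c]
    is the limit of [A]; comparing with the policy that stops promotion at time [s] bounds the
    discounted cost after [s] by [gamma exp (- theta s) (1 - f s)], which yields both the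
    convergence of [A] and [L -> 0].

    The maximum principle only gives the controls in terms of [Rmax 0 L].  Inserting them makes
    the costate equation linear, [L' = k L - theta gamma exp (- theta t)], and since [L] is
    positive at the end of the horizon it is positive throughout. *)

(** * Properties up to finitely many times *)

(** Controls have finitely many breakpoints over the whole horizon, so finite exceptional sets can
    replace null sets throughout, and no measure theory enters. *)
Definition almost (P : R -> Prop) : Prop :=
  exists l : list R, forall t, ~ In t l -> P t.

Lemma almost_all (P : R -> Prop) : (forall t, P t) -> almost P.
Proof. intros H; exists nil; auto. Qed.

Lemma almost_neq (x : R) : almost (fun t => t <> x).
Proof. exists (x :: nil); intros t Ht E; apply Ht; left; auto. Qed.

Lemma almost_mono (P Q : R -> Prop) :
  (forall t, P t -> Q t) -> almost P -> almost Q.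
Proof. intros H [l Hl]; exists l; auto. Qed.

Lemma almost_and (P Q : R -> Prop) :
  almost P -> almost Q -> almost (fun t => P t /\ Q t).
Proof.
  intros [l Hl] [m Hm]; exists (l ++ m); intros t Ht; split.
  - apply Hl; intro; apply Ht, in_or_app; auto.
  - apply Hm; intro; apply Ht, in_or_app; auto.
Qed.

Lemma almost_mono2 (P Q S : R -> Prop) :
  (forall t, P t -> Q t -> S t) -> almost P -> almost Q -> almost S.
Proof.
  intros H HP HQ; apply (almost_mono (fun t => P t /\ Q t)).
  - intros t [? ?]; auto.
  - apply almost_and; auto.
Qed.

Lemma almost_mono3 (P Q S W : R -> Prop) :
  (forall t, P t -> Q t -> S t -> W t) ->
  almost P -> almost Q -> almost S -> almost W.
Proof.
  intros H HP HQ HS; apply (almost_mono2 (fun t => P t /\ Q t) S).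
  - intros t [? ?] ?; auto.
  - apply almost_and; auto.
  - exact HS.
Qed.

(** Cutting an interval at the listed points reduces a property that is additive under concatenation
    to intervals free of exceptions. *)
Lemma list_interval_ind (P : R -> R -> Prop) (l : list R) :
  (forall a b, a < b -> (forall t, a < t < b -> ~ In t l) -> P a b) ->
  (forall a b c, a < b -> b < c -> P a b -> P b c -> P a c) ->
  forall a b, a < b -> P a b.
Proof.
  intros H0 Htr.
  (* The induction runs on a second list [m], required to contain only those points of [l] that lie
     in the current interval; a cut at its head removes the head on both sides. *)
  assert (G : forall m a b, a < b ->
    (forall t, a < t < b -> In t l -> In t m) -> P a b).
  { intro m; induction m as [|x m IH]; intros a b Hab Hm.
    - apply H0; [exact Hab|]; intros t Ht Hl; exact (Hm t Ht Hl).
    - destruct (classic (a < x < b)) as [Hx|Hx].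
      + apply (Htr a x b); try lra; apply IH; try lra; intros t Ht Hl;
          destruct (Hm t) as [E|E]; try lra; auto; subst; lra.
      + apply IH; [exact Hab|]; intros t Ht Hl; destruct (Hm t Ht Hl) as [E|E];
          auto; subst; contradiction. }
  intros a b Hab; apply (G l a b Hab); auto.
Qed.

(** The mean value theorem between consecutive exceptions, with the increments added up. Taking for
    [P] any nonempty convex cone of reals treats the signs [0 <= r], [0 < r] and [r = 0] at once. *)
Lemma increment_pos_of_derive (P : R -> Prop) (F : R -> R) (a b : R) :
  (exists r, P r) ->
  (forall r s, P r -> 0 < s -> P (r * s)) -> (forall r s, P r -> P s -> P (r + s)) ->
  (forall t, continuous F t) ->
  almost (fun t => a < t < b -> exists d, is_derive F t d /\ P d) ->
  a < b -> P (F b - F a).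
Proof.
  intros [r0 Hr0] Hs Hp Hc [l Hl] Hab.
  assert (G : forall x y, x < y -> (a <= x -> y <= b -> P (F y - F x))).
  { apply (list_interval_ind (fun x y => a <= x -> y <= b -> P (F y - F x)) l).
    - intros x y Hxy Hn Hx Hy.
      (* [MVT_gen] may return an endpoint, where the derivative is replaced by [r0] *)
      set (df := fun t => if excluded_middle_informative (P (Derive F t))
                          then Derive F t else r0).
      destruct (MVT_gen F x y df) as [c [_ ->]].
      + rewrite Rmin_left, Rmax_right by lra; intros t Ht.
        destruct (Hl t) as [d [Hd Pd]]; [auto|lra|].
        unfold df; rewrite (is_derive_unique _ _ _ Hd).
        destruct excluded_middle_informative; [exact Hd|contradiction].
      + intros t _; apply continuity_pt_filterlim, Hc.
      + apply Hs; [|lra]; unfold df; destruct excluded_middle_informative; auto.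
    - intros x y z Hxy Hyz H1 H2 Hx Hz.
      replace (F z - F x) with ((F y - F x) + (F z - F y)) by ring.
      apply Hp; [apply H1|apply H2]; lra. }
  apply G; lra.
Qed.

Lemma nondecreasing_of_derive (F : R -> R) (a b : R) :
  (forall t, continuous F t) ->
  almost (fun t => a < t < b -> exists d, is_derive F t d /\ 0 <= d) ->
  a <= b -> F a <= F b.
Proof.
  intros Hc Hd [Hab|<-]; [|lra].
  enough (0 <= F b - F a) by lra.
  apply (increment_pos_of_derive (fun r => 0 <= r)); auto; intros; try nra.
  exists 0; lra.
Qed.

Lemma increasing_of_derive (F : R -> R) (a b : R) :
  (forall t, continuous F t) ->
  almost (fun t => a < t < b -> exists d, is_derive F t d /\ 0 < d) ->
  a < b -> F a < F b.
Proof.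
  intros Hc Hd Hab.
  enough (0 < F b - F a) by lra.
  apply (increment_pos_of_derive (fun r => 0 < r)); auto; intros; try nra.
  exists 1; lra.
Qed.

Lemma constant_of_derive (F : R -> R) (a b : R) :
  (forall t, continuous F t) ->
  almost (fun t => a < t < b -> is_derive F t 0) ->
  a <= b -> F a = F b.
Proof.
  intros Hc Hd [Hab|<-]; [|reflexivity].
  enough (F b - F a = 0) by lra.
  apply (increment_pos_of_derive (fun r => r = 0)); auto; intros; subst; try ring.
  - exists 0; reflexivity.
  - revert Hd; apply almost_mono; intros t H Ht; exists 0; auto.
Qed.

(** * Piecewise continuous functions and their primitives *)

(** Whole-line counterpart of [piecewise_continuous]: primitives are then continuous on all of R,
    and no side conditions arise at the ends of the horizon. *)
Definition pc (g : R -> R) : Prop :=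
  almost (fun t => continuous g t) /\
  (forall t, exists r : R, filterlim g (at_right t) (locally r)) /\
  (forall t, exists r : R, filterlim g (at_left t) (locally r)).

Lemma pc_continuous (g : R -> R) : (forall t, continuous g t) -> pc g.
Proof.
  intros H; split; [apply almost_all, H|split; intro t; exists (g t)];
    apply filterlim_filter_le_1 with (2 := H t), filter_le_within.
Qed.

Lemma pc_comp2 (h : R -> R -> R) (f g : R -> R) :
  (forall x y, filterlim (fun z : R * R => h (fst z) (snd z))
     (filter_prod (locally x) (locally y)) (locally (h x y))) ->
  pc f -> pc g -> pc (fun t => h (f t) (g t)).
Proof.
  intros Hh [Cf [Rf Lf]] [Cg [Rg Lg]]; split; [|split].
  - revert Cf Cg; apply almost_mono2; intros t Ft Gt.
    exact (filterlim_comp_2 _ _ _ Ft Gt (Hh _ _)).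
  - intro t; destruct (Rf t) as [x Hx], (Rg t) as [y Hy]; exists (h x y).
    exact (filterlim_comp_2 _ _ _ Hx Hy (Hh _ _)).
  - intro t; destruct (Lf t) as [x Hx], (Lg t) as [y Hy]; exists (h x y).
    exact (filterlim_comp_2 _ _ _ Hx Hy (Hh _ _)).
Qed.

Lemma pc_plus (f g : R -> R) : pc f -> pc g -> pc (fun t => f t + g t).
Proof. apply (pc_comp2 Rplus); intros x y; exact (filterlim_plus (V := R_NormedModule) x y). Qed.

Lemma pc_mult (f g : R -> R) : pc f -> pc g -> pc (fun t => f t * g t).
Proof. apply (pc_comp2 Rmult); intros x y; exact (filterlim_mult (K := R_AbsRing) x y). Qed.

Lemma pc_const (c : R) : pc (fun _ => c).
Proof. apply pc_continuous; intro; apply continuous_const. Qed.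

Lemma pc_minus (f g : R -> R) : pc f -> pc g -> pc (fun t => f t - g t).
Proof.
  intros Hf Hg; assert (H : pc (fun t => f t + -1 * g t)).
  { apply pc_plus; [exact Hf|apply pc_mult; [apply pc_const|exact Hg]]. }
  replace (fun t => f t - g t) with (fun t => f t + -1 * g t); [exact H|].
  apply functional_extensionality; intro; ring.
Qed.

Lemma pc_sqrt (g : R -> R) : pc g -> pc (fun t => sqrt (g t)).
Proof.
  intros [Cg [Rg Lg]]; split; [|split].
  - revert Cg; apply almost_mono; intros t; apply continuous_sqrt_comp.
  - intro t; destruct (Rg t) as [r Hr]; exists (sqrt r).
    exact (filterlim_comp _ _ _ _ _ _ _ _ Hr (continuous_sqrt r)).
  - intro t; destruct (Lg t) as [r Hr]; exists (sqrt r).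
    exact (filterlim_comp _ _ _ _ _ _ _ _ Hr (continuous_sqrt r)).
Qed.

(** Between breakpoints the one-sided limits extend [g] continuously to the closed interval, and the
    Riemann integral ignores the end values. *)
Lemma pc_ex_RInt (g : R -> R) (a b : R) : pc g -> ex_RInt g a b.
Proof.
  intros [[l Hl] [Hr Hf]].
  assert (G : forall x y, x < y -> ex_RInt g x y).
  { apply (list_interval_ind (fun x y => ex_RInt g x y) l).
    - intros x y Hxy Hn.
      destruct (Hr x) as [rx Hx], (Hf y) as [ry Hy].
      destruct (C0_extension_lt g rx ry x y Hxy) as [h [Hh [E _]]]; auto.
      { intros c Hc; apply Hl, Hn, Hc. }
      apply ex_RInt_ext with h.
      + rewrite Rmin_left, Rmax_right by lra; exact E.
      + apply (ex_RInt_continuous (V := R_CompleteNormedModule)); intros z _; apply Hh.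
    - intros x y z _ _; apply ex_RInt_Chasles. }
  destruct (Rtotal_order a b) as [H|[<-|H]].
  - auto.
  - apply ex_RInt_point.
  - apply ex_RInt_swap; auto.
Qed.

Definition prim (g : R -> R) (t : R) : R := RInt g 0 t.

Lemma prim_0 (g : R -> R) : prim g 0 = 0.
Proof. exact (RInt_point 0 g). Qed.

Lemma prim_continuous (g : R -> R) (t : R) : pc g -> continuous (prim g) t.
Proof.
  intro H; apply continuous_RInt_1 with (f := g) (a := 0).
  apply filter_forall; intro z; apply (RInt_correct (V := R_CompleteNormedModule)).
  apply pc_ex_RInt, H.
Qed.

Lemma prim_derive_at (g : R -> R) (t : R) :
  pc g -> continuous g t -> is_derive (prim g) t (g t).
Proof.
  intros H Ht; apply is_derive_RInt with (a := 0); [|exact Ht].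
  apply filter_forall; intro z; apply (RInt_correct (V := R_CompleteNormedModule)).
  apply pc_ex_RInt, H.
Qed.

Lemma prim_derive (g : R -> R) :
  pc g -> almost (fun t => is_derive (prim g) t (g t)).
Proof.
  intros H; generalize (proj1 H); apply almost_mono; intros t; apply prim_derive_at, H.
Qed.

(** Meant for [h] a profit rate: it contains [Derive f], whose value at exceptional times is
    unspecified, so integrability is obtained from the piecewise continuous [g]. *)
Lemma RInt_of_derive (F g h : R -> R) (b : R) :
  (forall t, continuous F t) -> F 0 = 0 -> pc g -> 0 < b ->
  almost (fun t => 0 < t < b -> is_derive F t (g t)) ->
  almost (fun t => 0 < t < b -> h t = g t) ->
  RInt h 0 b = F b.
Proof.
  intros HF HF0 Hg Hb HFd [l Hl].
  assert (E : prim g b = F b).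
  { enough (F b - prim g b = F 0 - prim g 0) by (rewrite HF0, prim_0 in *; lra).
    symmetry; apply (constant_of_derive (fun t => F t - prim g t)); [| |lra].
    - intro t; apply (continuous_minus (V := R_NormedModule)); [apply HF|apply prim_continuous, Hg].
    - generalize (prim_derive g Hg); revert HFd; apply almost_mono2.
      intros t H1 H2 Ht; specialize (H1 Ht).
      replace 0 with (minus (g t) (g t)) by (unfold minus, plus, opp; simpl; ring).
      apply (is_derive_minus (V := R_NormedModule)); assumption. }
  rewrite <- E.
  assert (G : forall x y, x < y -> (0 <= x -> y <= b -> is_RInt h x y (RInt g x y))).
  { apply (list_interval_ind (fun x y => 0 <= x -> y <= b -> is_RInt h x y (RInt g x y)) l).
    - intros x y Hxy Hn Hx Hy; apply is_RInt_ext with g.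
      + rewrite Rmin_left, Rmax_right by lra; intros t Ht; symmetry; apply Hl; auto; lra.
      + apply (RInt_correct (V := R_CompleteNormedModule)), pc_ex_RInt, Hg.
    - intros x y z Hxy Hyz H1 H2 Hx Hz.
      rewrite <- (RInt_Chasles g x y z) by (apply pc_ex_RInt, Hg).
      apply (is_RInt_Chasles (V := R_NormedModule)) with y; [apply H1|apply H2]; lra. }
  apply is_RInt_unique, G; lra.
Qed.

(** * Automation for continuity, piecewise continuity and derivatives *)

Ltac cont :=
  repeat match goal with
    | |- continuous (fun x => @?a x + @?b x) _ =>
        apply (continuous_plus (V := R_NormedModule) a b)
    | |- continuous (fun x => @?a x - @?b x) _ =>
        apply (continuous_minus (V := R_NormedModule) a b)
    | |- continuous (fun x => @?a x * @?b x) _ =>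
        apply (continuous_mult (K := R_AbsRing) a b)
    | |- continuous (fun x => - @?a x) _ =>
        apply (continuous_opp (V := R_NormedModule) a)
    | |- continuous (fun x => / @?a x) _ => apply (continuous_Rinv_comp a)
    | |- continuous (fun x => exp (@?a x)) _ => apply (continuous_exp_comp a)
    | |- continuous (fun x => sqrt (@?a x)) _ => apply (continuous_sqrt_comp a)
    | |- continuous (fun x => x) _ => apply continuous_id
    | |- continuous (fun _ => ?c) _ => apply continuous_const
    | |- continuous (fun x => prim ?g x) _ => apply (prim_continuous g)
    | |- continuous (prim ?g) _ => apply (prim_continuous g)
    | H : forall t, continuous ?f t |- continuous ?f _ => apply H
    | H : forall t, continuous ?f t |- continuous (fun x => ?f x) _ => apply H
    | H : pc ?f |- pc ?f => exact H
    | H : continuous ?f ?t |- continuous ?f ?t => exact H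
    | H : continuous ?f ?t |- continuous (fun x => ?f x) ?t => exact H
  end.

Ltac pcs :=
  repeat match goal with
    | H : pc ?f |- pc ?f => exact H
    | H : pc ?f |- pc (fun x => ?f x) => exact H
    | |- pc (fun x => @?a x + @?b x) => apply (pc_plus a b)
    | |- pc (fun x => @?a x - @?b x) => apply (pc_minus a b)
    | |- pc (fun x => @?a x * @?b x) => apply (pc_mult a b)
    | |- pc (fun x => sqrt (@?a x)) => apply (pc_sqrt a)
    | |- pc (fun _ => ?c) => apply pc_const
  end;
  try match goal with |- pc _ => apply pc_continuous; intro; cont end.

Lemma derive_value (F : R -> R) (t d d' : R) :
  is_derive F t d -> d = d' -> is_derive F t d'.
Proof. intros H <-; exact H. Qed.

(* Derivatives of the functions occurring in the goal are read off from the hypotheses. *)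
Ltac diff :=
  match goal with |- is_derive ?F ?t ?d =>
    eapply derive_value;
    [ auto_derive; [repeat split; try (eexists; eassumption) | reflexivity]
    | repeat match goal with H : is_derive ?F ?t ?d |- _ =>
        rewrite (is_derive_unique (fun x : R => F x) t d H)
      end ]
  end.

(** The integrating factor [exp (- prim k)] yields a first integral, from which the positivity of
    [1 - f] and the uniqueness of the state are read off. *)
Lemma linear_ode (d k : R -> R) (a b : R) :
  (forall t, continuous d t) -> pc k ->
  almost (fun t => a < t < b -> is_derive d t (k t * d t)) -> a <= b ->
  d a * exp (- prim k a) = d b * exp (- prim k b).
Proof.
  intros Hd Hk Hder Hab.
  apply (constant_of_derive (fun t => d t * exp (- prim k t))); [|  |exact Hab].
  - intro t; cont.
  - generalize (prim_derive k Hk); revert Hder; apply almost_mono2.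
    intros t H1 H2 Ht; specialize (H1 Ht); diff; ring.
Qed.

(** * The state equation *)

Definition solves (p q f : R -> R) : Prop :=
  (forall t, continuous f t) /\ f 0 = 0 /\
  almost (fun t => is_derive f t ((1 - f t) * (p t + q t * f t))).

(* The substitution [w = / (1 - f)] turns the equation for [f] into the linear equation
   [w' = (p + q) w - q]. *)
Lemma solution_exists (p q : R -> R) :
  pc p -> pc q -> (forall t, 0 <= p t) -> (forall t, 0 <= q t) ->
  exists f, solves p q f.
Proof.
  intros Hp Hq Hp0 Hq0.
  set (E := fun t => exp (prim (fun s => p s + q s) t)).
  assert (HE : forall t, 0 < E t) by (intro; apply exp_pos).
  assert (HEc : forall t, continuous E t).
  { intro t; unfold E; cont; pcs. }
  assert (HE' : almost (fun t => is_derive E t ((p t + q t) * E t))).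
  { generalize (prim_derive (fun s => p s + q s) ltac:(pcs)); apply almost_mono.
    intros t Ht; unfold E; diff; ring. }
  set (k := fun s => q s * / E s).
  assert (Hk : pc k).
  { unfold k; pcs; apply Rgt_not_eq, HE. }
  (* Variation of constants: [w = E * V] solves the linear equation with [w 0 = 1]. *)
  set (V := fun t => 1 - prim k t).
  assert (HVc : forall t, continuous V t) by (intro t; unfold V; cont).
  assert (HV' : almost (fun t => is_derive V t (- (q t * / E t)))).
  { generalize (prim_derive k Hk); apply almost_mono.
    intros t Ht; unfold V; diff; unfold k; ring. }
  (* Forward in time, [V - / E] vanishes at 0 and has derivative [p / E >= 0], so [V >= / E]. At
     negative times [V >= V 0 = 1], because [V] is nonincreasing. *)
  assert (HV : forall t, 0 < V t).
  { intro t; destruct (Rle_or_lt 0 t) as [Ht|Ht].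
    - enough (V 0 - / E 0 <= V t - / E t) as H.
      { unfold V at 1, E at 1 in H; rewrite !prim_0, exp_0, Rinv_1 in H.
        generalize (Rinv_0_lt_compat _ (HE t)); lra. }
      apply (nondecreasing_of_derive (fun t => V t - / E t)); [| |exact Ht].
      + intro s; cont; specialize (HE s); lra.
      + revert HE' HV'; apply almost_mono2; intros s H1 H2 _.
        exists (p s * / E s); split.
        * assert (E s <> 0) by (specialize (HE s); lra); diff; [auto|field; auto].
        * generalize (Rinv_0_lt_compat _ (HE s)) (Hp0 s); nra.
    - enough (V 0 <= V t) as H.
      { unfold V at 1 in H; rewrite prim_0 in H; lra. }
      enough (- V t <= - V 0) by lra.
      apply (nondecreasing_of_derive (fun t => - V t)); [| |lra].
      + intro s; cont.
      + revert HV'; apply almost_mono; intros s H _.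
        exists (q s * / E s); split; [diff; ring|].
        generalize (Rinv_0_lt_compat _ (HE s)) (Hq0 s); nra. }
  exists (fun t => 1 - / (E t * V t)); split; [|split].
  - intro t; cont; specialize (HE t); specialize (HV t); nra.
  - unfold E, V; rewrite !prim_0, exp_0; field.
  - revert HE' HV'; apply almost_mono2; intros t H1 H2.
    assert (E t <> 0) by (specialize (HE t); lra).
    assert (V t <> 0) by (specialize (HV t); lra).
    diff; [apply Rmult_integral_contrapositive; auto|field; auto].
Qed.

(** [1 - f] solves a homogeneous linear equation with rate [- (p + q f)] and starts at 1, hence
    never vanishes or changes sign. *)
Lemma solution_lt_1 (p q f : R -> R) (t : R) :
  pc p -> pc q -> solves p q f -> f t < 1.
Proof.
  intros Hp Hq [Hf [H0 Hf']].
  set (k := fun s => - 1 * (p s + q s * f s)).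
  assert (Hk : pc k) by (unfold k; pcs).
  assert (G : forall a b, a <= b ->
    (1 - f a) * exp (- prim k a) = (1 - f b) * exp (- prim k b)).
  { intros a b; apply (linear_ode (fun s => 1 - f s) k); [intro; cont|exact Hk|].
    revert Hf'; apply almost_mono; intros s Hs _; diff; unfold k; ring. }
  assert (H : (1 - f t) * exp (- prim k t) = 1).
  { transitivity ((1 - f 0) * exp (- prim k 0)).
    - destruct (Rle_or_lt 0 t); [symmetry|]; apply G; lra.
    - rewrite H0, prim_0, Ropp_0, exp_0; ring. }
  generalize (exp_pos (- prim k t)); nra.
Qed.

Section Solution.

Variables p q f : R -> R.
Hypothesis (Hp : pc p) (Hq : pc q) (Hf : solves p q f).
Hypothesis (Hp0 : forall t, 0 <= p t) (Hq0 : forall t, 0 <= q t).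

Let Q := prim (fun s => q s * (1 - f s)).

Lemma solution_weight_pc : pc (fun s => q s * (1 - f s)).
Proof. destruct Hf as [Hc _]; pcs. Qed.

Lemma solution_weight_derive : almost (fun t => is_derive Q t (q t * (1 - f t))).
Proof. exact (prim_derive _ solution_weight_pc). Qed.

Lemma solution_weight_nonneg (t : R) : 0 <= t -> 0 <= Q t.
Proof.
  intros Ht; unfold Q; rewrite <- (prim_0 (fun s => q s * (1 - f s))).
  apply nondecreasing_of_derive; [| |exact Ht].
  - intro s; apply prim_continuous, solution_weight_pc.
  - generalize solution_weight_derive; apply almost_mono; intros s H _.
    exists (q s * (1 - f s)); split; [exact H|].
    generalize (Hq0 s) (solution_lt_1 p q f s Hp Hq Hf); nra.
Qed.

(** The factor [exp (- Q)] absorbs the internal term [q (1 - f) f]; only the external term is left,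
    and its sign gives both the positivity of [f] and the bound on [Q]. *)
Lemma solution_ratio_derive :
  almost (fun t => is_derive (fun t => f t * exp (- Q t)) t
                     ((1 - f t) * p t * exp (- Q t))).
Proof.
  destruct Hf as [Hc [H0 Hf']]; generalize solution_weight_derive; revert Hf'.
  apply almost_mono2; intros t H1 H2; diff; ring.
Qed.

Lemma solution_ratio_continuous (t : R) : continuous (fun t => f t * exp (- Q t)) t.
Proof.
  destruct Hf as [Hc [H0 Hf']]; unfold Q; cont; apply solution_weight_pc.
Qed.

Lemma solution_ratio_mono (a b : R) :
  a <= b -> f a * exp (- Q a) <= f b * exp (- Q b).
Proof.
  apply (nondecreasing_of_derive (fun t => f t * exp (- Q t))).
  - exact solution_ratio_continuous.
  - generalize solution_ratio_derive; apply almost_mono; intros t Ht _.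
    eexists; split; [exact Ht|].
    generalize (Hp0 t) (solution_lt_1 p q f t Hp Hq Hf) (exp_pos (- Q t)); intros.
    repeat apply Rmult_le_pos; lra.
Qed.

Lemma solution_nonneg (t : R) : 0 <= t -> 0 <= f t.
Proof.
  intro Ht; generalize (solution_ratio_mono 0 t Ht) (exp_pos (- Q t)).
  rewrite (proj1 (proj2 Hf)); nra.
Qed.

Lemma solution_pos (t : R) : (forall s, 0 < p s) -> 0 < t -> 0 < f t.
Proof.
  intros Hpp Ht.
  enough (f 0 * exp (- Q 0) < f t * exp (- Q t)) as H.
  { rewrite (proj1 (proj2 Hf)) in H; generalize (exp_pos (- Q t)); nra. }
  apply (increasing_of_derive (fun t => f t * exp (- Q t))).
  - exact solution_ratio_continuous.
  - generalize solution_ratio_derive; apply almost_mono; intros s Hs _.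
    eexists; split; [exact Hs|].
    generalize (Hpp s) (solution_lt_1 p q f s Hp Hq Hf) (exp_pos (- Q s)); intros.
    repeat apply Rmult_lt_0_compat; lra.
  - exact Ht.
Qed.

(** Follows from [f a exp (- Q a) <= f t exp (- Q t) <= exp (- Q t)]. The bound does not involve
    [t], which is what makes estimates uniform over an infinite horizon. *)
Lemma solution_weight_bound (a t : R) :
  0 <= a <= t -> 0 < f a -> exp (Q t) <= exp (Q a) / f a.
Proof.
  intros Ha Hfa; generalize (solution_ratio_mono a t (proj2 Ha)); intro H.
  assert (f t * exp (- Q t) <= exp (- Q t)).
  { generalize (solution_lt_1 p q f t Hp Hq Hf) (exp_pos (- Q t)); nra. }
  rewrite !exp_Ropp in *.
  generalize (exp_pos (Q a)) (exp_pos (Q t)); intros.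
  assert (f a * / exp (Q a) <= / exp (Q t)) by lra.
  apply Rmult_le_reg_r with (f a * / exp (Q a)).
  { apply Rmult_lt_0_compat; [auto|apply Rinv_0_lt_compat; auto]. }
  replace (exp (Q a) / f a * (f a * / exp (Q a))) with 1 by (field; lra).
  rewrite <- (Rinv_r (exp (Q t))) by lra.
  apply Rmult_le_compat_l; lra.
Qed.

End Solution.

(** * Policies and their gain *)

Definition switch (a : R) (g h : R -> R) (t : R) : R :=
  if Rlt_dec t a then g t else h t.

Lemma switch_left (a : R) (g h : R -> R) (t : R) : t < a -> switch a g h t = g t.
Proof. intros H; unfold switch; destruct Rlt_dec; [reflexivity|contradiction]. Qed.

Lemma switch_right (a : R) (g h : R -> R) (t : R) : a <= t -> switch a g h t = h t.
Proof. intros H; unfold switch; destruct Rlt_dec; [lra|reflexivity]. Qed.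

Lemma locally_lt (a t : R) : t < a -> locally t (fun s => s < a).
Proof.
  intros H; apply (locally_interval _ t m_infty a); simpl; auto.
Qed.

Lemma locally_gt (a t : R) : a < t -> locally t (fun s => a < s).
Proof.
  intros H; apply (locally_interval _ t a p_infty); simpl; auto.
Qed.

Lemma pc_switch (a : R) (g h : R -> R) : pc g -> pc h -> pc (switch a g h).
Proof.
  intros [Cg [Rg Lg]] [Ch [Rh Lh]]; split; [|split].
  - generalize (almost_neq a); revert Cg Ch; apply almost_mono3; intros t Hg Hh Ht.
    destruct (Rlt_or_le t a) as [H|H].
    + apply continuous_ext_loc with g; [|exact Hg].
      generalize (locally_lt a t H); apply filter_imp; intros s Hs.
      symmetry; apply switch_left, Hs.
    + apply continuous_ext_loc with h; [|exact Hh].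
      generalize (locally_gt a t ltac:(lra)); apply filter_imp; intros s Hs.
      symmetry; apply switch_right; lra.
  - intro t; destruct (Rlt_or_le t a) as [H|H].
    + destruct (Rg t) as [r Hr]; exists r; revert Hr; apply filterlim_ext_loc.
      unfold at_right, within; generalize (locally_lt a t H); apply filter_imp.
      intros s Hs _; symmetry; apply switch_left, Hs.
    + destruct (Rh t) as [r Hr]; exists r; revert Hr; apply filterlim_ext_loc.
      unfold at_right, within; apply filter_forall.
      intros s Hs; symmetry; apply switch_right; lra.
  - intro t; destruct (Rlt_or_le a t) as [H|H].
    + destruct (Lh t) as [r Hr]; exists r; revert Hr; apply filterlim_ext_loc.
      unfold at_left, within; generalize (locally_gt a t H); apply filter_imp.
      intros s Hs _; symmetry; apply switch_right; lra.
    + destruct (Lg t) as [r Hr]; exists r; revert Hr; apply filterlim_ext_loc.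
      unfold at_left, within; apply filter_forall.
      intros s Hs; symmetry; apply switch_left; lra.
Qed.

Definition control (s : R -> R) : Prop := pc s /\ forall t, 0 <= s t.

Lemma control_const (c : R) : 0 <= c -> control (fun _ => c).
Proof. intros H; split; [apply pc_const|auto]. Qed.

Lemma control_switch (a : R) (g h : R -> R) :
  control g -> control h -> control (switch a g h).
Proof.
  intros [Pg Ng] [Ph Nh]; split; [apply pc_switch; auto|].
  intro t; unfold switch; destruct Rlt_dec; auto.
Qed.

(** One predicate expresses, for finite and infinite horizons alike, both the terminal condition of
    the costate and the final comparison of gains. *)
Definition late (T : Rbar) (P : R -> Prop) : Prop :=
  match T with
  | Finite b => P b
  | _ => exists a, forall t, a <= t -> P t
  end.

Lemma late_and (T : Rbar) (P Q : R -> Prop) :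
  late T P -> late T Q -> late T (fun t => P t /\ Q t).
Proof.
  destruct T as [b| |]; simpl; [auto| |];
  intros [a Ha] [c Hc]; exists (Rmax a c); intros t Ht;
    (split; [apply Ha|apply Hc]; eapply Rle_trans; [|exact Ht|  |exact Ht];
       [apply Rmax_l|apply Rmax_r]).
Qed.

Lemma late_mono (T : Rbar) (P Q : R -> Prop) :
  (forall t, P t -> Q t) -> late T P -> late T Q.
Proof.
  intro H; destruct T as [b| |]; simpl; [auto| |]; intros [a Ha]; exists a; auto.
Qed.

Lemma late_after (T : Rbar) (a : R) :
  inside_horizon T a -> late T (fun t => in_horizon T t /\ a <= t).
Proof.
  intros [Ha HT]; destruct T as [b| |]; simpl in *; [|exists a; intros t Ht|easy];
    unfold in_horizon; simpl; lra.
Qed.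

(** * The promotion problem with square-root effects *)

Section Promotion.

Variables p0 q0 bp bq gamma theta : R.
Hypotheses (Hp0 : 0 < p0) (Hq0 : 0 < q0) (Hbp : 0 < bp) (Hbq : 0 < bq).
Hypotheses (Hgamma : 0 < gamma) (Htheta : 0 <= theta).

Definition disc (t : R) : R := exp (- theta * t).

Lemma disc_pos (t : R) : 0 < disc t.
Proof. apply exp_pos. Qed.

Lemma disc_continuous (t : R) : continuous disc t.
Proof. unfold disc; cont. Qed.

Lemma disc_derive (t : R) : is_derive disc t (- theta * disc t).
Proof. unfold disc; auto_derive; [auto|ring]. Qed.

Lemma disc_decr (s t : R) : s <= t -> disc t <= disc s.
Proof.
  intros H; unfold disc; destruct (Req_dec (- theta * t) (- theta * s)) as [->|N]; [lra|].
  left; apply exp_increasing; nra.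
Qed.

Lemma disc_le_1 (t : R) : 0 <= t -> disc t <= 1.
Proof.
  intros H; replace 1 with (disc 0); [apply disc_decr, H|].
  unfold disc; rewrite Rmult_0_r; apply exp_0.
Qed.

Definition ext (s : R -> R) (t : R) : R := promotion_effect p0 bp (s t).
Definition int (s : R -> R) (t : R) : R := promotion_effect q0 bq (s t).

Lemma ext_pos (s : R -> R) (t : R) : 0 < ext s t.
Proof. unfold ext, promotion_effect; generalize (sqrt_pos (s t)); nra. Qed.

Lemma int_pos (s : R -> R) (t : R) : 0 < int s t.
Proof. unfold int, promotion_effect; generalize (sqrt_pos (s t)); nra. Qed.

Lemma ext_pc (s : R -> R) : control s -> pc (ext s).
Proof. intros [H _]; unfold ext, promotion_effect; pcs. Qed.

Lemma int_pc (s : R -> R) : control s -> pc (int s).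
Proof. intros [H _]; unfold int, promotion_effect; pcs. Qed.

Definition policy (sp sq f : R -> R) : Prop :=
  control sp /\ control sq /\ solves (ext sp) (int sq) f.

Lemma policy_exists (sp sq : R -> R) :
  control sp -> control sq -> exists f, policy sp sq f.
Proof.
  intros Hp Hq; destruct (solution_exists (ext sp) (int sq)) as [f Hf].
  - apply ext_pc, Hp.
  - apply int_pc, Hq.
  - intro; left; apply ext_pos.
  - intro; left; apply int_pos.
  - exists f; split; [|split]; assumption.
Qed.

Definition revenue_rate (sp sq f : R -> R) (t : R) : R :=
  gamma * disc t * ((1 - f t) * (ext sp t + int sq t * f t)).

Definition cost_rate (sp sq f : R -> R) (t : R) : R :=
  disc t * (1 - f t) * (sp t + f t * sq t).

(** Accumulated profit, with [f'] replaced by the right-hand side of its equation. Revenue and cost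
    are kept apart because the first is bounded and the second is nondecreasing, so each has a limit
    of its own. *)
Definition gain (sp sq f : R -> R) (t : R) : R :=
  prim (revenue_rate sp sq f) t - prim (cost_rate sp sq f) t.

Definition weight (sq f : R -> R) : R -> R := prim (fun s => int sq s * (1 - f s)).

Section Policy.

Variables sp sq f : R -> R.
Hypothesis Hpol : policy sp sq f.

Let Hext : pc (ext sp).
Proof. apply ext_pc, Hpol. Qed.

Let Hint : pc (int sq).
Proof. apply int_pc, Hpol. Qed.

Let Hc : forall t, continuous f t.
Proof. apply Hpol. Qed.

Let Hd := disc_continuous.

Lemma policy_lt_1 (t : R) : f t < 1.
Proof. apply (solution_lt_1 (ext sp) (int sq)); auto; apply Hpol. Qed.

Lemma policy_nonneg (t : R) : 0 <= t -> 0 <= f t.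
Proof.
  apply (solution_nonneg (ext sp) (int sq)); auto; [apply Hpol|].
  intro; left; apply ext_pos.
Qed.

Lemma policy_pos (t : R) : 0 < t -> 0 < f t.
Proof.
  apply (solution_pos (ext sp) (int sq)); auto; [apply Hpol|].
  intro; apply ext_pos.
Qed.

Lemma policy_derive :
  almost (fun t => is_derive f t ((1 - f t) * (ext sp t + int sq t * f t))).
Proof. apply Hpol. Qed.

Lemma policy_speed_nonneg (t : R) :
  0 <= t -> 0 <= (1 - f t) * (ext sp t + int sq t * f t).
Proof.
  intros Ht; generalize (policy_lt_1 t) (policy_nonneg t Ht) (ext_pos sp t) (int_pos sq t).
  intros; apply Rmult_le_pos; [lra|]; nra.
Qed.

Lemma weight_derive : almost (fun t => is_derive (weight sq f) t (int sq t * (1 - f t))).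
Proof. apply (solution_weight_derive (ext sp) (int sq)); auto; apply Hpol. Qed.

Lemma weight_continuous (t : R) : continuous (weight sq f) t.
Proof. unfold weight; cont; pcs. Qed.

Lemma weight_nonneg (t : R) : 0 <= t -> 0 <= weight sq f t.
Proof.
  apply (solution_weight_nonneg (ext sp) (int sq)); auto; [apply Hpol|].
  intro; left; apply int_pos.
Qed.

Lemma weight_bound (a t : R) :
  0 < a <= t -> exp (weight sq f t) <= exp (weight sq f a) / f a.
Proof.
  intros H; apply (solution_weight_bound (ext sp) (int sq)); auto; try lra.
  - apply Hpol.
  - intro; left; apply ext_pos.
  - apply policy_pos; lra.
Qed.

Lemma revenue_rate_pc : pc (revenue_rate sp sq f).
Proof. unfold revenue_rate; pcs. Qed.

Lemma cost_rate_pc : pc (cost_rate sp sq f).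
Proof. destruct Hpol as [[? _] [[? _] _]]; unfold cost_rate; pcs. Qed.

Lemma cost_rate_nonneg (t : R) : 0 <= t -> 0 <= cost_rate sp sq f t.
Proof.
  intros Ht; destruct Hpol as [[_ Np] [[_ Nq] _]]; unfold cost_rate.
  generalize (disc_pos t) (policy_lt_1 t) (policy_nonneg t Ht) (Np t) (Nq t); intros.
  apply Rmult_le_pos; [apply Rmult_le_pos; lra|nra].
Qed.

Lemma cost_mono (s t : R) :
  0 <= s <= t -> prim (cost_rate sp sq f) s <= prim (cost_rate sp sq f) t.
Proof.
  intros H; apply nondecreasing_of_derive; [| |lra].
  - intro; apply prim_continuous, cost_rate_pc.
  - generalize (prim_derive _ cost_rate_pc); apply almost_mono; intros u Hu Hr.
    eexists; split; [exact Hu|apply cost_rate_nonneg; lra].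
Qed.

(** Discounting all later adoptions only from time [s] can only increase their revenue. As [f < 1],
    revenue is bounded over any horizon. *)
Lemma revenue_bounds (s t : R) : 0 <= s <= t ->
  0 <= prim (revenue_rate sp sq f) t - prim (revenue_rate sp sq f) s
    <= gamma * disc s * (f t - f s).
Proof.
  intros H; split.
  - enough (prim (revenue_rate sp sq f) s <= prim (revenue_rate sp sq f) t) by lra.
    apply nondecreasing_of_derive; [| |lra].
    + intro; apply prim_continuous, revenue_rate_pc.
    + generalize (prim_derive _ revenue_rate_pc); apply almost_mono; intros u Hu Hr.
      eexists; split; [exact Hu|].
      generalize (disc_pos u) (policy_speed_nonneg u ltac:(lra)); intros.
      unfold revenue_rate; apply Rmult_le_pos; [nra|auto].
  - enough (gamma * disc s * f s - prim (revenue_rate sp sq f) s <=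
            gamma * disc s * f t - prim (revenue_rate sp sq f) t) by lra.
    apply (nondecreasing_of_derive
             (fun t => gamma * disc s * f t - prim (revenue_rate sp sq f) t)); [| |lra].
    + intro; cont; apply revenue_rate_pc.
    + generalize (prim_derive _ revenue_rate_pc) policy_derive; apply almost_mono2.
      intros u H1 H2 Hr; eexists; split; [diff; reflexivity|].
      generalize (disc_decr s u ltac:(lra)) (policy_speed_nonneg u ltac:(lra)); intros.
      unfold revenue_rate; set (v := (1 - f u) * _) in *.
      enough (0 <= gamma * ((disc s - disc u) * v)) by lra.
      apply Rmult_le_pos; [lra|apply Rmult_le_pos; lra].
Qed.

Lemma gain_continuous (t : R) : continuous (gain sp sq f) t.
Proof. unfold gain; cont; [apply revenue_rate_pc|apply cost_rate_pc]. Qed.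

Lemma gain_derive :
  almost (fun t => is_derive (gain sp sq f) t
    (disc t * ((1 - f t) * (gamma * (ext sp t + int sq t * f t) - (sp t + f t * sq t))))).
Proof.
  generalize (prim_derive _ revenue_rate_pc) (prim_derive _ cost_rate_pc).
  apply almost_mono2; intros t H1 H2; unfold gain; diff.
  unfold revenue_rate, cost_rate; ring.
Qed.

End Policy.

Lemma gain_0 (sp sq f : R -> R) : gain sp sq f 0 = 0.
Proof. unfold gain; rewrite !prim_0; ring. Qed.

(** * Comparison of two policies *)

Section Comparison.

Variables sp sq f sp' sq' f' : R -> R.
Hypotheses (Hpol : policy sp sq f) (Hpol' : policy sp' sq' f').

Let Hc : forall t, continuous f t.
Proof. apply Hpol. Qed.

Let Hc' : forall t, continuous f' t.
Proof. apply Hpol'. Qed.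

(* Two solutions for the same controls: their difference is a constant multiple of
   [(1 - f) * exp (weight sq' f')]. *)
Lemma difference_ratio (a b : R) : a <= b ->
  (forall t, a < t < b -> sp' t = sp t /\ sq' t = sq t) ->
  (f' a - f a) * / (1 - f a) * exp (- weight sq' f' a) =
  (f' b - f b) * / (1 - f b) * exp (- weight sq' f' b).
Proof.
  intros Hab Heq.
  apply (constant_of_derive
    (fun t => (f' t - f t) * / (1 - f t) * exp (- weight sq' f' t))); [| |exact Hab].
  - intro t; generalize (policy_lt_1 _ _ _ Hpol t) (weight_continuous _ _ _ Hpol'); intros.
    cont; lra.
  - generalize (policy_derive _ _ _ Hpol) (policy_derive _ _ _ Hpol')
      (weight_derive _ _ _ Hpol').
    apply almost_mono3; intros t H1 H2 H3 Ht; destruct (Heq t Ht) as [Ep Eq].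
    generalize (policy_lt_1 _ _ _ Hpol t); intro Hlt.
    diff; [lra|]; unfold ext, int in *; rewrite Ep, Eq; field; lra.
Qed.

(** Causality: the invariant of [difference_ratio] is zero at time 0, so the states coincide, and
    then so do the derivatives of weight and gain. *)
Lemma same_controls (b : R) : 0 <= b ->
  (forall t, 0 < t < b -> sp' t = sp t /\ sq' t = sq t) ->
  f' b = f b /\ weight sq' f' b = weight sq f b /\ gain sp' sq' f' b = gain sp sq f b.
Proof.
  intros Hb Heq.
  assert (Ef : forall t, 0 <= t <= b -> f' t = f t).
  { intros t Ht; generalize (difference_ratio 0 t (proj1 Ht)
      ltac:(intros; apply Heq; lra)) (policy_lt_1 _ _ _ Hpol t).
    destruct Hpol as [_ [_ [_ [-> _]]]]; destruct Hpol' as [_ [_ [_ [-> _]]]].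
    intros H Hlt; assert (E : (f' t - f t) * (/ (1 - f t) * exp (- weight sq' f' t)) = 0) by lra.
    apply Rmult_integral in E; destruct E as [E|E]; [lra|exfalso].
    generalize (Rinv_0_lt_compat (1 - f t) ltac:(lra)) (exp_pos (- weight sq' f' t)); nra. }
  split; [apply Ef; lra|split].
  - enough (weight sq' f' b - weight sq f b = weight sq' f' 0 - weight sq f 0) as E.
    { unfold weight at 3 4 in E; rewrite !prim_0 in E; lra. }
    symmetry; apply (constant_of_derive (fun t => weight sq' f' t - weight sq f t)); [| |exact Hb].
    + generalize (weight_continuous _ _ _ Hpol) (weight_continuous _ _ _ Hpol').
      intros ? ? t; cont.
    + generalize (weight_derive _ _ _ Hpol) (weight_derive _ _ _ Hpol').
      apply almost_mono2; intros t H1 H2 Ht; destruct (Heq t Ht) as [Ep Eq].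
      diff; unfold int; rewrite Eq, (Ef t) by lra; ring.
  - enough (gain sp' sq' f' b - gain sp sq f b = gain sp' sq' f' 0 - gain sp sq f 0) as E.
    { rewrite !gain_0 in E; lra. }
    symmetry; apply (constant_of_derive (fun t => gain sp' sq' f' t - gain sp sq f t)); [| |exact Hb].
    + generalize (gain_continuous _ _ _ Hpol) (gain_continuous _ _ _ Hpol').
      intros ? ? t; cont.
    + generalize (gain_derive _ _ _ Hpol) (gain_derive _ _ _ Hpol').
      apply almost_mono2; intros t H1 H2 Ht; destruct (Heq t Ht) as [Ep Eq].
      diff; unfold int, ext; rewrite Ep, Eq, (Ef t) by lra; ring.
Qed.

End Comparison.

(** * Needle variations *)

(** The Pontryagin Hamiltonian without its common positive factor [1 - f]; the revenue is merged
    into the multiplier [lam = Psi + gamma exp (- theta t)], and [e] is the discount factor. *)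
Definition hamiltonian (lam e f sp sq : R) : R :=
  lam * (promotion_effect p0 bp sp + promotion_effect q0 bq sq * f) - e * (sp + f * sq).

(** Here [L = Psi + gamma exp (- theta t)]: this shift produces the [theta * gamma] term, and the
    last clause is [Psi(T) = 0]. Boundedness keeps the second-order error of a needle uniform when
    the horizon is infinite. *)
Definition is_costate (T : Rbar) (sp sq f L : R -> R) : Prop :=
  (forall t, continuous L t) /\
  almost (fun t => is_derive L t
    (L t * (ext sp t + int sq t * (2 * f t - 1))
     - disc t * (sp t + (2 * f t - 1) * sq t + theta * gamma))) /\
  (exists M, forall t, in_horizon T t -> Rabs (L t) <= M) /\
  (forall eps, 0 < eps -> late T (fun t => Rabs (L t - gamma * disc t) <= eps)).

Section Needle.

Variables (T : Rbar) (sp sq f L : R -> R).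
Hypothesis Hpol : policy sp sq f.
Hypothesis HL : is_costate T sp sq f L.

Variables sp' sq' f' : R -> R.
Hypothesis Hpol' : policy sp' sq' f'.

(* The costate turns the change of the gain into a pointwise comparison of Hamiltonians, up
   to a term of second order in [f' - f]. *)
Definition advantage (t : R) : R :=
  gain sp' sq' f' t - gain sp sq f t + (L t - gamma * disc t) * (f' t - f t).

Lemma advantage_continuous (t : R) : continuous advantage t.
Proof.
  destruct HL as [HLc _]; unfold advantage.
  generalize (gain_continuous _ _ _ Hpol) (gain_continuous _ _ _ Hpol') disc_continuous.
  destruct Hpol as [_ [_ [Hc _]]]; destruct Hpol' as [_ [_ [Hc' _]]].
  intros; cont.
Qed.

(** The cofactor of [f' - f] in the derivative of [advantage]. Where the two controls agree, it
    reduces to [- (f' - f) (L q - disc sq)], so that its contribution is of second order. *)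
Definition remainder (t : R) : R :=
  L t * (- ext sp' t + int sq' t * (1 - f t - f' t)
         + ext sp t + int sq t * (2 * f t - 1))
  - disc t * (- sp' t + sq' t * (1 - f t - f' t) + sp t + (2 * f t - 1) * sq t).

Lemma advantage_derive :
  almost (fun t => is_derive advantage t
    ((1 - f t) * (hamiltonian (L t) (disc t) (f t) (sp' t) (sq' t)
                  - hamiltonian (L t) (disc t) (f t) (sp t) (sq t))
     + (f' t - f t) * remainder t)).
Proof.
  destruct HL as [_ [HLd _]].
  assert (H := almost_and _ _ (gain_derive _ _ _ Hpol) (gain_derive _ _ _ Hpol')).
  assert (H' := almost_and _ _ (policy_derive _ _ _ Hpol) (policy_derive _ _ _ Hpol')).
  revert HLd H H'; apply almost_mono3; intros t H1 [H2 H3] [H4 H5].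
  generalize (disc_derive t); intro H6; unfold advantage; diff.
  unfold remainder, hamiltonian; fold (ext sp t) (ext sp' t) (int sq t) (int sq' t); ring.
Qed.

Lemma remainder_bound (M t : R) : 0 <= t -> Rabs (L t) <= M ->
  Rabs (remainder t) <=
  M * (ext sp' t + int sq' t + ext sp t + int sq t) + (sp' t + sq' t + sp t + sq t).
Proof.
  intros Ht HM.
  generalize (policy_nonneg _ _ _ Hpol t Ht) (policy_lt_1 _ _ _ Hpol t)
    (policy_nonneg _ _ _ Hpol' t Ht) (policy_lt_1 _ _ _ Hpol' t)
    (ext_pos sp t) (int_pos sq t) (ext_pos sp' t) (int_pos sq' t)
    (proj2 (proj1 Hpol) t) (proj2 (proj1 Hpol') t)
    (proj2 (proj1 (proj2 Hpol)) t) (proj2 (proj1 (proj2 Hpol')) t)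
    (disc_pos t) (disc_le_1 t Ht); intros.
  assert (E : forall a b c d r s, 0 <= a -> 0 <= b -> 0 <= c -> 0 <= d -> -1 <= r <= 1 -> -1 <= s <= 1 ->
    Rabs (- a + b * r + c + d * s) <= a + b + c + d).
  { intros a b c d r s Ha Hb Hc Hd Hr Hs.
    assert (- b <= b * r <= b) by nra; assert (- d <= d * s <= d) by nra.
    apply Rabs_le; lra. }
  unfold remainder.
  eapply Rle_trans; [apply Rabs_triang|rewrite Rabs_Ropp, !Rabs_mult].
  apply Rplus_le_compat.
  - apply Rmult_le_compat; try apply Rabs_pos; [exact HM|].
    apply E; lra.
  - rewrite (Rabs_pos_eq (disc t)) by lra.
    rewrite <- (Rmult_1_l (sp' t + _ + _ + _)).
    apply Rmult_le_compat; try apply Rabs_pos; try lra.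
    rewrite (Rmult_comm (2 * f t - 1)); apply E; lra.
Qed.

(* On the needle [t0, t0 + e], [|f' - f| <= B e]; afterwards [difference_ratio] propagates this
   to [|f' - f| <= K e (1 - f)], so that the quadratic loss is controlled by the weight, which
   never exceeds [W]. *)
Lemma needle_gain (t0 e eta B C M : R) :
  0 < t0 -> 0 < e -> 0 <= C -> inside_horizon T (t0 + e) ->
  (forall t, in_horizon T t -> Rabs (L t) <= M) ->
  (forall t, 0 < t < t0 -> sp' t = sp t /\ sq' t = sq t) ->
  (forall t, t0 + e < t -> sp' t = sp t /\ sq' t = sq t) ->
  (forall t, t0 < t < t0 + e -> ext sp t + int sq t <= B /\ ext sp' t + int sq' t <= B) ->
  (forall t, t0 < t < t0 + e -> Rabs (remainder t) <= C) ->
  (forall t, t0 < t < t0 + e -> 2 * eta <=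
     (1 - f t) * (hamiltonian (L t) (disc t) (f t) (sp' t) (sq' t)
                  - hamiltonian (L t) (disc t) (f t) (sp t) (sq t))) ->
  (1 - f t0) / 2 <= 1 - f (t0 + e) ->
  C * B * e <= eta ->
  let W := exp (weight sq f t0) / f t0 in
  let K := 2 * B * W / (1 - f t0) in
  forall t, in_horizon T t -> t0 + e <= t ->
    e * eta - M * W * K ^ 2 * e ^ 2 <= advantage t.
Proof.
  intros Ht0 He HC HTe HM Hl Hr HB Hrem Hham Hhalf Hsmall W K t HTt Ht.
  set (t1 := t0 + e) in *.
  assert (Hc : forall t, continuous f t) by apply Hpol.
  assert (Hc' : forall t, continuous f' t) by apply Hpol'.
  destruct (same_controls _ _ _ _ _ _ Hpol Hpol' t0 ltac:(lra) Hl) as [Ef [Ew Eg]].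
  assert (Hadv0 : advantage t0 = 0).
  { unfold advantage; rewrite Ef, Eg; ring. }
  (* On the needle both adoption speeds lie in [[0, B]], so the states separate at rate at most
     [B]. *)
  assert (Hd : forall s, t0 <= s <= t1 -> Rabs (f' s - f s) <= B * (s - t0)).
  { intros s Hs.
    assert (Hsp : almost (fun u => t0 < u < s ->
      is_derive f u ((1 - f u) * (ext sp u + int sq u * f u)) /\
      is_derive f' u ((1 - f' u) * (ext sp' u + int sq' u * f' u)) /\
      0 <= (1 - f u) * (ext sp u + int sq u * f u) <= B /\
      0 <= (1 - f' u) * (ext sp' u + int sq' u * f' u) <= B)).
    { generalize (policy_derive _ _ _ Hpol) (policy_derive _ _ _ Hpol').
      apply almost_mono2; intros u H1 H2 Hu; split; [exact H1|split; [exact H2|]].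
      assert (Hu0 : 0 <= u) by lra.
      generalize (policy_nonneg _ _ _ Hpol u Hu0) (policy_lt_1 _ _ _ Hpol u)
        (policy_nonneg _ _ _ Hpol' u Hu0) (policy_lt_1 _ _ _ Hpol' u)
        (ext_pos sp u) (int_pos sq u) (ext_pos sp' u) (int_pos sq' u)
        (policy_speed_nonneg _ _ _ Hpol u Hu0) (policy_speed_nonneg _ _ _ Hpol' u Hu0); intros.
      destruct (HB u ltac:(lra)).
      assert (E : forall g P I, 0 <= g < 1 -> 0 < P -> 0 < I -> P + I <= B ->
        (1 - g) * (P + I * g) <= B).
      { intros g P I Hg HP HI HPI; apply Rle_trans with (1 * (P + I)); [|lra].
        apply Rmult_le_compat; nra. }
      repeat split; auto; apply E; auto; lra. }
    apply Rabs_le; split.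
    - enough (f' t0 - f t0 + B * t0 <= f' s - f s + B * s) by lra.
      apply (nondecreasing_of_derive (fun u => f' u - f u + B * u)); [intro; cont| |lra].
      revert Hsp; apply almost_mono; intros u Hu Hur; destruct (Hu Hur) as [H1 [H2 H3]].
      eexists; split; [diff; reflexivity|lra].
    - enough (f t0 - f' t0 + B * t0 <= f s - f' s + B * s) by lra.
      apply (nondecreasing_of_derive (fun u => f u - f' u + B * u)); [intro; cont| |lra].
      revert Hsp; apply almost_mono; intros u Hu Hur; destruct (Hu Hur) as [H1 [H2 H3]].
      eexists; split; [diff; reflexivity|lra]. }
  assert (HB0 : 0 <= B).
  { destruct (HB ((t0 + t1) / 2)) as [H _]; [unfold t1; lra|].
    generalize (ext_pos sp ((t0 + t1) / 2)) (int_pos sq ((t0 + t1) / 2)); lra. }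
  (* The Hamiltonian difference gains at rate at least [2 eta], of which the remainder takes at most
     [C B e <= eta]. *)
  assert (H1 : e * eta <= advantage t1).
  { enough (advantage t0 - eta * t0 <= advantage t1 - eta * t1) by (unfold t1 in *; lra).
    apply (nondecreasing_of_derive (fun u => advantage u - eta * u)); [| |unfold t1; lra].
    - generalize advantage_continuous; intros ? u; cont.
    - generalize advantage_derive; apply almost_mono; intros u Hu Hur.
      eexists; split; [diff; reflexivity|].
      assert (Hdr : Rabs ((f' u - f u) * remainder u) <= eta).
      { rewrite Rabs_mult; apply Rle_trans with (B * e * C); [|lra].
        apply Rmult_le_compat; try apply Rabs_pos; [|apply Hrem, Hur].
        eapply Rle_trans; [apply Hd; lra|].
        apply Rmult_le_compat_l; [exact HB0|unfold t1 in *; lra]. }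
      apply Rabs_le_between in Hdr; specialize (Hham u Hur); lra. }
  assert (Hf0 : 0 < f t0) by (apply (policy_pos _ _ _ Hpol); lra).
  assert (Hf1 := policy_lt_1 _ _ _ Hpol).
  (* State and weight agree for both policies up to [t0], so the same [W] bounds both weights
     afterwards. *)
  assert (HW : forall s, t0 <= s -> exp (weight sq' f' s) <= W).
  { intros s Hs; unfold W; rewrite <- Ef, <- Ew; apply (weight_bound _ _ _ Hpol'); lra. }
  assert (HW' : forall s, t0 <= s -> exp (weight sq f s) <= W).
  { intros s Hs; apply (weight_bound _ _ _ Hpol); lra. }
  assert (HW0 : 0 < W).
  { generalize (HW t0 ltac:(lra)) (exp_pos (weight sq' f' t0)); lra. }
  clearbody W.
  assert (HK : 0 <= K).
  { unfold K, Rdiv; specialize (Hf1 t0).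
    generalize (Rinv_0_lt_compat (1 - f t0) ltac:(lra)); intro.
    repeat apply Rmult_le_pos; lra. }
  (* In [K], the factor [2 / (1 - f t0)] bounds [/ (1 - f t1)], [B] comes from the needle, and [W]
     bounds the exponential of the weight. *)
  assert (Hdr : forall s, t1 <= s -> Rabs (f' s - f s) <= K * e * (1 - f s)).
  { intros s Hs.
    assert (E := difference_ratio _ _ _ _ _ _ Hpol Hpol' t1 s Hs ltac:(intros; apply Hr; lra)).
    replace (f' s - f s) with
      ((f' s - f s) * / (1 - f s) * exp (- weight sq' f' s)
        * ((1 - f s) * exp (weight sq' f' s))).
    2: { rewrite exp_Ropp; field; split; [apply Rgt_not_eq, exp_pos|specialize (Hf1 s); lra]. }
    rewrite <- E, !Rabs_mult.
    rewrite (Rabs_pos_eq (1 - f s)) by (specialize (Hf1 s); lra).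
    rewrite !(Rabs_pos_eq (exp _)) by (left; apply exp_pos).
    rewrite Rabs_inv, (Rabs_pos_eq (1 - f t1)) by (specialize (Hf1 t1); lra).
    assert (HtI : / (1 - f t1) <= 2 / (1 - f t0)).
    { specialize (Hf1 t0); replace (2 / (1 - f t0)) with (/ ((1 - f t0) / 2)) by (field; lra).
      apply Rinv_le_contravar; lra. }
    assert (HeW : exp (- weight sq' f' t1) <= 1).
    { rewrite <- exp_0; generalize (weight_nonneg _ _ _ Hpol' t1 ltac:(unfold t1; lra)).
      intros [Hw|<-]; [left; apply exp_increasing; lra|rewrite Ropp_0; lra]. }
    specialize (Hd t1 ltac:(unfold t1; lra)); replace (t1 - t0) with e in Hd by (unfold t1; ring).
    generalize (HW s ltac:(unfold t1 in *; lra)) (exp_pos (weight sq' f' s))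
      (exp_pos (- weight sq' f' t1)) (Rabs_pos (f' t1 - f t1))
      (Rinv_0_lt_compat (1 - f t1) ltac:(specialize (Hf1 t1); lra)) (Hf1 s); intros.
    replace (K * e * (1 - f s)) with ((B * e * (2 / (1 - f t0)) * 1) * ((1 - f s) * W))
      by (unfold K; field; specialize (Hf1 t0); lra).
    repeat apply Rmult_le_compat; try lra; repeat apply Rmult_le_pos; lra. }
  assert (HM0 : 0 <= M).
  { apply Rle_trans with (Rabs (L t)); [apply Rabs_pos|auto]. }
  set (c := M * K ^ 2 * e ^ 2).
  assert (Hcc : 0 <= c).
  { unfold c; apply Rmult_le_pos; [apply Rmult_le_pos; [exact HM0|]|]; apply pow2_ge_0. }
  (* After the needle, the loss [(f' - f)^2 L q] is at most [K^2 e^2 (1 - f) M q], which is [c]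
     times the derivative of the weight. The other quadratic term, with [disc * sq], has the
     favourable sign. *)
  assert (H2 : advantage t1 + c * weight sq f t1 <= advantage t + c * weight sq f t).
  { apply (nondecreasing_of_derive (fun u => advantage u + c * weight sq f u)); [| |exact Ht].
    - generalize advantage_continuous (weight_continuous _ _ _ Hpol); intros ? ? u; cont.
    - generalize advantage_derive (weight_derive _ _ _ Hpol); apply almost_mono2.
      intros u Hu1 Hu2 Hur; eexists; split; [diff; reflexivity|].
      assert (HTu : in_horizon T u).
      { destruct HTt as [_ HTt]; split; [unfold t1 in *; lra|].
        apply Rbar_le_trans with t; [simpl; lra|exact HTt]. }
      destruct (Hr u ltac:(lra)) as [Ep Eq].
      specialize (Hdr u ltac:(lra)); specialize (HM u HTu).
      unfold remainder, ext, int; rewrite Ep, Eq; fold (ext sp u) (int sq u).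
      generalize (int_pos sq u) (disc_pos u) (proj2 (proj1 (proj2 Hpol)) u)
        (Hf1 u) (policy_nonneg _ _ _ Hpol u ltac:(unfold t1 in *; lra)); intros.
      replace (1 * _ + c * (1 * _)) with
        (c * (int sq u * (1 - f u)) - (f' u - f u) ^ 2 * (L u * int sq u)
         + (f' u - f u) ^ 2 * (disc u * sq u)) by ring.
      assert (Hs : (f' u - f u) ^ 2 <= K ^ 2 * e ^ 2 * (1 - f u)).
      { rewrite <- (pow2_abs (f' u - f u)).
        apply Rle_trans with ((K * e * (1 - f u)) ^ 2).
        - apply pow_incr; split; [apply Rabs_pos|exact Hdr].
        - rewrite !Rpow_mult_distr; apply Rmult_le_compat_l; [|nra].
          apply Rmult_le_pos; apply pow2_ge_0. }
      apply Rabs_le_between in HM.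
      assert ((f' u - f u) ^ 2 * (L u * int sq u) <= c * (int sq u * (1 - f u))).
      { apply Rle_trans with ((f' u - f u) ^ 2 * (M * int sq u)).
        - apply Rmult_le_compat_l; [apply pow2_ge_0|nra].
        - replace (c * (int sq u * (1 - f u))) with
            ((K ^ 2 * e ^ 2 * (1 - f u)) * (M * int sq u)) by (unfold c; ring).
          apply Rmult_le_compat_r; [nra|exact Hs]. }
      assert (0 <= (f' u - f u) ^ 2 * (disc u * sq u)).
      { apply Rmult_le_pos; [apply pow2_ge_0|nra]. }
      lra. }
  assert (Hwt : weight sq f t <= W).
  { generalize (HW' t ltac:(unfold t1 in *; lra)) (exp_ineq1_le (weight sq f t)); lra. }
  assert (Hwt1 := weight_nonneg _ _ _ Hpol t1 ltac:(unfold t1; lra)).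
  replace (M * W * K ^ 2 * e ^ 2) with (c * W) by (unfold c; ring).
  nra.
Qed.

End Needle.

(** Optimality in the form used by comparison arguments: a lead by a fixed amount at the end of the
    horizon is excluded, without reference to limits of gains. *)
Definition unimprovable (T : Rbar) (sp sq f : R -> R) : Prop :=
  forall sp' sq' f' kappa, policy sp' sq' f' -> 0 < kappa ->
    ~ late T (fun t => gain sp sq f t + kappa <= gain sp' sq' f' t).

Lemma inside_horizon_locally (T : Rbar) (t : R) :
  inside_horizon T t -> locally t (inside_horizon T).
Proof.
  intros [H0 HT]; apply (locally_interval _ t 0 T); auto.
  intros s Hs Hs'; split; auto.
Qed.

Lemma continuous_locally_gt (g : R -> R) (t a : R) :
  continuous g t -> a < g t -> locally t (fun s => a < g s).
Proof. intros Hg Ha; exact (Hg _ (locally_gt a (g t) Ha)). Qed.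

Lemma continuous_locally_lt (g : R -> R) (t a : R) :
  continuous g t -> g t < a -> locally t (fun s => g s < a).
Proof. intros Hg Ha; exact (Hg _ (locally_lt a (g t) Ha)). Qed.

(** If [(a, b)] had a larger Hamiltonian, continuity would preserve the excess near [t0], and a
    needle of length [e] with values [a], [b] would gain to order [e] and lose only to order
    [e^2]. *)
Lemma maximum_principle (T : Rbar) (sp sq f L : R -> R) (t0 a b : R) :
  policy sp sq f -> is_costate T sp sq f L -> unimprovable T sp sq f ->
  inside_horizon T t0 -> continuous sp t0 -> continuous sq t0 -> 0 <= a -> 0 <= b ->
  hamiltonian (L t0) (disc t0) (f t0) a b <=
  hamiltonian (L t0) (disc t0) (f t0) (sp t0) (sq t0).
Proof.
  intros Hpol HL Hun Ht0 Csp Csq Ha Hb.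
  apply Rnot_lt_le; intro Hlt.
  generalize HL; intros [HLc [HLd [[M HM] HLT]]].
  assert (Hc : forall t, continuous f t) by apply Hpol.
  assert (Hf1 := policy_lt_1 _ _ _ Hpol).
  assert (Hf0 : 0 < f t0) by (apply (policy_pos _ _ _ Hpol), Ht0).
  set (g := fun t => (1 - f t) * (hamiltonian (L t) (disc t) (f t) a b
                       - hamiltonian (L t) (disc t) (f t) (sp t) (sq t))).
  assert (Hg : continuous g t0).
  { generalize disc_continuous; intro.
    unfold g, hamiltonian, promotion_effect; cont. }
  set (eta := g t0 / 4).
  assert (Heta : 0 < eta).
  { unfold eta, g; specialize (Hf1 t0).
    apply Rdiv_lt_0_compat; [apply Rmult_lt_0_compat; lra|lra]. }
  (* [B] and [S] dominate effects and spending of both policies near [t0]: the 1 allows for the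
     variation of the original controls, and the constant ones are evaluated at the arbitrary time
     0. *)
  set (B := ext sp t0 + int sq t0 + 1 + ext (fun _ => a) 0 + int (fun _ => b) 0).
  set (S := sp t0 + sq t0 + 1 + a + b).
  assert (Hpa := ext_pos (fun _ => a) 0); assert (Hpb := int_pos (fun _ => b) 0).
  assert (Hsp0 := ext_pos sp t0); assert (Hsq0 := int_pos sq t0).
  assert (Hs0 := proj2 (proj1 Hpol) t0); assert (Hs0' := proj2 (proj1 (proj2 Hpol)) t0).
  assert (HM0 : 0 <= M).
  { apply Rle_trans with (Rabs (L t0)); [apply Rabs_pos|apply HM].
    destruct Ht0 as [Ht0 HT0]; split; [lra|apply Rbar_lt_le, HT0]. }
  set (C := M * (B + B) + S).
  assert (HC : 0 <= C) by (unfold C, B, S; nra).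
  assert (Hloc : locally t0 (fun t => inside_horizon T t /\ 2 * eta < g t /\
    ext sp t + int sq t < ext sp t0 + int sq t0 + 1 /\
    sp t + sq t < sp t0 + sq t0 + 1 /\ (1 - f t0) / 2 < 1 - f t)).
  { apply filter_and; [apply inside_horizon_locally, Ht0|].
    apply filter_and; [apply continuous_locally_gt; [exact Hg|unfold eta; unfold eta in Heta; lra]|].
    apply filter_and.
    { apply (continuous_locally_lt (fun t => ext sp t + int sq t)); [|lra].
      unfold ext, int, promotion_effect; cont. }
    apply filter_and.
    { apply (continuous_locally_lt (fun t => sp t + sq t)); [cont|lra]. }
    apply (continuous_locally_gt (fun t => 1 - f t)); [cont|specialize (Hf1 t0); lra]. }
  destruct Hloc as [r Hr].
  set (W := exp (weight sq f t0) / f t0).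
  set (K := 2 * B * W / (1 - f t0)).
  assert (HW : 0 < W) by (apply Rdiv_lt_0_compat; [apply exp_pos|exact Hf0]).
  assert (HD1 : 0 <= C * B) by (apply Rmult_le_pos; unfold B; lra).
  assert (HD2 : 0 <= M * W * K ^ 2).
  { apply Rmult_le_pos; [apply Rmult_le_pos; lra|apply pow2_ge_0]. }
  (* With [e <= eta / D], both [C B e <= eta] and [M W K^2 e <= eta / 2] hold; [e <= r / 2] keeps
     the needle in the neighbourhood. *)
  set (D := C * B + 2 * (M * W * K ^ 2) + 1).
  set (e := Rmin (r / 2) (eta / D)).
  assert (HD : 0 < D) by (unfold D; lra).
  assert (Her : e <= r / 2) by apply Rmin_l.
  assert (HeD : e * D <= eta).
  { apply Rle_trans with (eta / D * D); [|right; field; lra].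
    apply Rmult_le_compat_r; [lra|apply Rmin_r]. }
  assert (He : 0 < e).
  { apply Rmin_pos; [generalize (cond_pos r); lra|apply Rdiv_lt_0_compat; lra]. }
  assert (HeD1 := Rmult_le_pos _ _ (Rlt_le _ _ He) HD1).
  assert (HeD2 := Rmult_le_pos _ _ (Rlt_le _ _ He) HD2).
  unfold D in HeD.
  assert (Hball : forall t, t0 <= t <= t0 + e -> ball t0 r t).
  { intros t Ht; unfold ball; simpl; unfold AbsRing_ball, abs, minus, plus, opp; simpl.
    apply Rabs_def1; generalize (cond_pos r); lra. }
  set (sp' := switch t0 sp (switch (t0 + e) (fun _ => a) sp)).
  set (sq' := switch t0 sq (switch (t0 + e) (fun _ => b) sq)).
  assert (Hin : forall t, t0 < t < t0 + e -> sp' t = a /\ sq' t = b).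
  { intros t Ht; unfold sp', sq'.
    rewrite !(switch_right t0), !(switch_left (t0 + e)) by lra; auto. }
  destruct (policy_exists sp' sq') as [f' Hpol'].
  { apply control_switch; [apply Hpol|apply control_switch; [apply control_const, Ha|apply Hpol]]. }
  { apply control_switch; [apply Hpol|apply control_switch; [apply control_const, Hb|apply Hpol]]. }
  assert (Hadv : forall t, in_horizon T t -> t0 + e <= t ->
    e * eta - M * W * K ^ 2 * e ^ 2 <= advantage sp sq f L sp' sq' f' t).
  { apply (needle_gain T sp sq f L Hpol HL sp' sq' f' Hpol' t0 e eta B C M);
      try exact HM; try exact He; try exact HC.
    - apply Ht0.
    - apply Hr, Hball; lra.
    - intros t Ht; unfold sp', sq'; rewrite !(switch_left t0) by lra; auto.
    - intros t Ht; unfold sp', sq'; 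
      rewrite !(switch_right t0), !(switch_right (t0 + e)) by lra; auto.
    - intros t Ht; destruct (Hr t (Hball t ltac:(lra))) as [_ [_ [HB _]]].
      destruct (Hin t Ht) as [E1 E2]; unfold B; unfold ext, int in *; rewrite E1, E2; lra.
    - intros t Ht; destruct (Hr t (Hball t ltac:(lra))) as [HTt [_ [HB [HS _]]]].
      destruct HTt as [HTt HTt'].
      eapply Rle_trans; [apply (remainder_bound sp sq f L Hpol sp' sq' f' Hpol' M); [lra|]|].
      { apply HM; split; [lra|apply Rbar_lt_le, HTt']. }
      destruct (Hin t Ht) as [E1 E2]; unfold C, B, S; unfold ext, int in *; rewrite E1, E2.
      apply Rplus_le_compat; [apply Rmult_le_compat_l|]; lra.
    - intros t Ht; destruct (Hr t (Hball t ltac:(lra))) as [_ [Hgt _]].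
      destruct (Hin t Ht) as [-> ->]; unfold g in Hgt; lra.
    - destruct (Hr (t0 + e) (Hball (t0 + e) ltac:(lra))) as [_ [_ [_ [_ Hgt]]]]; lra.
    - lra. }
  (* From [e eta], half goes to the quadratic loss and a quarter to the terminal term
     [Psi (f' - f)]; the last quarter is the lead. *)
  apply (Hun sp' sq' f' (e * eta / 4) Hpol'); [apply Rdiv_lt_0_compat; [nra|lra]|].
  assert (HT1 : inside_horizon T (t0 + e)) by (apply Hr, Hball; lra).
  generalize (late_and _ _ _ (late_after _ _ HT1) (HLT (e * eta / 4) ltac:(nra))).
  apply late_mono; intros t [[HTt Ht] HPsi].
  specialize (Hadv t HTt Ht); unfold advantage in Hadv.
  assert (Ht' : 0 <= t) by apply HTt.
  generalize (policy_nonneg _ _ _ Hpol t Ht') (policy_lt_1 _ _ _ Hpol t)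
    (policy_nonneg _ _ _ Hpol' t Ht') (policy_lt_1 _ _ _ Hpol' t); intros.
  assert (Rabs ((L t - gamma * disc t) * (f' t - f t)) <= e * eta / 4 * 1).
  { rewrite Rabs_mult; apply Rmult_le_compat; try apply Rabs_pos; [exact HPsi|].
    apply Rabs_le; lra. }
  assert (M * W * K ^ 2 * e ^ 2 <= e * eta / 2).
  { replace (M * W * K ^ 2 * e ^ 2) with (e * (M * W * K ^ 2 * e)) by ring.
    replace (e * eta / 2) with (e * (eta / 2)) by field.
    apply Rmult_le_compat_l; lra. }
  apply Rabs_le_between in H3; lra.
Qed.

(** In the variable [u = sqrt s] the objective is a concave quadratic, and testing the hypothesis at
    its maximizer on the half-line identifies [s]. *)
Lemma scalar_maximizer (k e s : R) : 0 < e -> 0 <= s ->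
  (forall u, 0 <= u -> k * u - e * u ^ 2 <= k * sqrt s - e * s) ->
  s = (Rmax 0 k / (2 * e)) ^ 2.
Proof.
  intros He Hs H.
  generalize (sqrt_pos s) (pow2_sqrt s Hs); set (v := sqrt s) in *; intros Hv Es.
  clearbody v; subst s.
  set (w := Rmax 0 k / (2 * e)).
  assert (Hw : 0 <= w).
  { apply Rdiv_le_0_compat; [apply Rmax_l|lra]. }
  assert (Ew : 2 * e * w = Rmax 0 k) by (unfold w; field; lra).
  specialize (H w Hw).
  enough (v = w) as -> by reflexivity.
  destruct (Rle_or_lt 0 k) as [Hk|Hk].
  - rewrite Rmax_right in Ew by exact Hk.
    assert (e * (v - w) ^ 2 <= 0) by (rewrite <- Ew in H; nra).
    assert ((v - w) ^ 2 <= 0) by nra; nra.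
  - rewrite Rmax_left in Ew by lra; assert (w = 0) by nra.
    assert (0 <= e * v ^ 2) by (apply Rmult_le_pos; [lra|apply pow2_ge_0]).
    subst w; rewrite H0 in *; nra.
Qed.

(** The Hamiltonian separates in the two controls. The internal part carries the common factor
    [f > 0], which cancels; this is why both optimal levels have the same shape. *)
Lemma hamiltonian_maximizer (l e f sp sq : R) :
  0 < e -> 0 < f -> 0 <= sp -> 0 <= sq ->
  (forall a b, 0 <= a -> 0 <= b -> hamiltonian l e f a b <= hamiltonian l e f sp sq) ->
  sp = bp ^ 2 / 4 * (Rmax 0 l / e) ^ 2 /\ sq = bq ^ 2 / 4 * (Rmax 0 l / e) ^ 2.
Proof.
  intros He Hf Hsp Hsq H; unfold hamiltonian, promotion_effect in H.
  assert (Hm : forall c, 0 < c -> Rmax 0 (l * c) = Rmax 0 l * c).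
  { intros c Hc; unfold Rmax; destruct (Rle_dec 0 (l * c)), (Rle_dec 0 l); nra. }
  split.
  - rewrite (scalar_maximizer (l * bp) e sp) at 1; [rewrite Hm by exact Hbp; field; lra|auto|auto|].
    intros u Hu; specialize (H (u ^ 2) sq (pow2_ge_0 u) Hsq).
    rewrite sqrt_pow2 in H by exact Hu; lra.
  - rewrite (scalar_maximizer (l * bq) e sq) at 1; [rewrite Hm by exact Hbq; field; lra|auto|auto|].
    intros u Hu; specialize (H sp (u ^ 2) Hsp (pow2_ge_0 u)).
    rewrite sqrt_pow2 in H by exact Hu.
    apply Rmult_le_reg_l with f; [exact Hf|nra].
Qed.

(** * Existence and positivity of the costate *)

Lemma late_exists (T : Rbar) (P : R -> Prop) (s : R) : Rbar_lt 0 T ->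
  in_horizon T s -> late T P -> exists t, s <= t /\ in_horizon T t /\ P t.
Proof.
  intros HT [Hs HsT] H; destruct T as [b| |]; simpl in *; [| |easy].
  - exists b; unfold in_horizon; simpl; repeat split; auto; lra.
  - destruct H as [a Ha]; exists (Rmax a s); generalize (Rmax_l a s) (Rmax_r a s).
    intros; unfold in_horizon; simpl; repeat split; auto; lra.
Qed.

Section Costate.

Variables sp sq f : R -> R.
Hypothesis Hpol : policy sp sq f.

(* Integrating factor of the costate equation. *)
Definition factor (t : R) : R := (1 - f t) * exp (weight sq f t).

Definition source (t : R) : R :=
  factor t * (disc t * (sp t + (2 * f t - 1) * sq t + theta * gamma)).

Definition costate (c t : R) : R := (c - prim source t) * / factor t.

Lemma factor_pos (t : R) : 0 < factor t.
Proof.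
  generalize (policy_lt_1 _ _ _ Hpol t); intro.
  apply Rmult_lt_0_compat; [lra|apply exp_pos].
Qed.

Lemma factor_continuous (t : R) : continuous factor t.
Proof.
  generalize (weight_continuous _ _ _ Hpol) (proj1 (proj2 (proj2 Hpol))); intros.
  unfold factor; cont.
Qed.

Lemma factor_derive :
  almost (fun t => is_derive factor t (- (ext sp t + int sq t * (2 * f t - 1)) * factor t)).
Proof.
  generalize (policy_derive _ _ _ Hpol) (weight_derive _ _ _ Hpol).
  apply almost_mono2; intros t H1 H2; unfold factor; diff; ring.
Qed.

Lemma source_pc : pc source.
Proof.
  generalize factor_continuous disc_continuous (proj1 (proj2 (proj2 Hpol))); intros.
  destruct Hpol as [[? _] [[? _] _]]; unfold source; pcs.
Qed.

Lemma costate_continuous (c t : R) : continuous (costate c) t.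
Proof.
  generalize factor_continuous source_pc; intros.
  unfold costate; cont; apply Rgt_not_eq, factor_pos.
Qed.

Lemma costate_derive (c : R) : almost (fun t => is_derive (costate c) t
  (costate c t * (ext sp t + int sq t * (2 * f t - 1))
   - disc t * (sp t + (2 * f t - 1) * sq t + theta * gamma))).
Proof.
  generalize factor_derive (prim_derive _ source_pc); apply almost_mono2.
  intros t H1 H2; assert (H3 := Rgt_not_eq _ _ (factor_pos t)).
  unfold costate; diff; [exact H3|unfold source; field; exact H3].
Qed.

Lemma continuous_bounded (g : R -> R) (a b : R) :
  (forall t, continuous g t) -> exists M, forall t, a <= t <= b -> Rabs (g t) <= M.
Proof.
  intros H; destruct (bounded_continuity (V := R_NormedModule) g a b) as [M HM].
  - intros t _; apply H.
  - exists M; intros t Ht; left; exact (HM t Ht).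
Qed.

Lemma costate_exists_finite (b : R) : 0 < b -> exists L, is_costate b sp sq f L.
Proof.
  (* The constant is the one for which [L b = gamma * disc b]. *)
  intros Hb; exists (costate (prim source b + gamma * disc b * factor b)).
  split; [apply costate_continuous|split; [apply costate_derive|split]].
  - destruct (continuous_bounded (costate (prim source b + gamma * disc b * factor b)) 0 b)
      as [M HM]; [apply costate_continuous|].
    exists M; intros t [H1 H2]; apply HM; simpl in H2; lra.
  - intros eps Heps; simpl; unfold costate.
    replace (_ - _) with 0 by (field; apply Rgt_not_eq, factor_pos).
    rewrite Rabs_R0; lra.
Qed.

(* Comparison with the policy that stops all promotion at time [s]. *)
Lemma tail_cost : unimprovable p_infty sp sq f -> forall s t, 0 <= s <= t ->
  prim (cost_rate sp sq f) t - prim (cost_rate sp sq f) s <= gamma * disc s * (1 - f s).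
Proof.
  intros Hun s t Hst; apply Rnot_lt_le; intro Hlt.
  set (sp' := switch s sp (fun _ => 0)); set (sq' := switch s sq (fun _ => 0)).
  destruct (policy_exists sp' sq') as [f' Hpol'].
  { apply control_switch; [apply Hpol|apply control_const; lra]. }
  { apply control_switch; [apply Hpol|apply control_const; lra]. }
  (* The stopping policy saves at least the cost between [s] and [t], and forgoes at most the
     revenue [gamma * disc s * (1 - f s)]; the difference is its lead from [t] on. *)
  apply (Hun sp' sq' f' (prim (cost_rate sp sq f) t - prim (cost_rate sp sq f) s
                         - gamma * disc s * (1 - f s)) Hpol'); [lra|].
  exists t; intros u Hu.
  destruct (same_controls _ _ _ _ _ _ Hpol Hpol' s) as [_ [_ Eg]]; [lra| |].
  { intros v Hv; unfold sp', sq'; rewrite !(switch_left s) by lra; auto. }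
  assert (Hc' : prim (cost_rate sp' sq' f') s = prim (cost_rate sp' sq' f') u).
  { apply (constant_of_derive (prim (cost_rate sp' sq' f'))); [| |lra].
    - intro; apply prim_continuous, cost_rate_pc, Hpol'.
    - generalize (prim_derive _ (cost_rate_pc _ _ _ Hpol')); apply almost_mono.
      intros v H Hv; apply (derive_value _ _ _ _ H).
      unfold cost_rate, sp', sq'; rewrite !(switch_right s) by lra; ring. }
  generalize (revenue_bounds _ _ _ Hpol' s u ltac:(lra)) (revenue_bounds _ _ _ Hpol s u ltac:(lra))
    (cost_mono _ _ _ Hpol t u ltac:(lra)) (policy_lt_1 _ _ _ Hpol u) (disc_pos s); intros.
  assert (gamma * disc s * (f u - f s) <= gamma * disc s * (1 - f s)).
  { apply Rmult_le_compat_l; [nra|lra]. }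
  unfold gain in *; lra.
Qed.

Lemma disc_limit : 0 < theta -> forall eps, 0 < eps -> exists a, forall t, a <= t -> disc t <= eps.
Proof.
  intros Hth eps Heps; exists (- ln eps / theta); intros t Ht.
  unfold disc; rewrite <- (exp_ln eps Heps).
  assert (H : - ln eps <= t * theta).
  { apply Rmult_le_compat_r with (r := theta) in Ht; [|lra].
    replace (- ln eps / theta * theta) with (- ln eps) in Ht by (field; lra); exact Ht. }
  destruct (Req_dec (- theta * t) (ln eps)) as [->|N]; [lra|].
  left; apply exp_increasing; lra.
Qed.

(** The rate [p0] alone makes [exp (p0 t) (1 - f)] nonincreasing, and [exp (p0 t) >= 2] once
    [p0 t >= 1]. From then on [2 f - 1 >= 0], which fixes the sign of [source]. *)
Lemma adoption_half : exists a, 0 < a /\ forall t, a <= t -> 1 / 2 <= f t.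
Proof.
  assert (Hc : forall t, continuous f t) by apply Hpol.
  assert (H : forall t, 0 <= t -> exp (p0 * t) * (1 - f t) <= 1).
  { intros t Ht; assert (H0 : f 0 = 0) by apply Hpol.
    enough (- (exp (p0 * 0) * (1 - f 0)) <= - (exp (p0 * t) * (1 - f t))) as H.
    { rewrite Rmult_0_r, exp_0, H0 in H; lra. }
    apply (nondecreasing_of_derive (fun t => - (exp (p0 * t) * (1 - f t)))); [intro; cont| |exact Ht].
    generalize (policy_derive _ _ _ Hpol); apply almost_mono; intros u H1 Hu.
    eexists; split; [diff; reflexivity|].
    generalize (policy_lt_1 _ _ _ Hpol u) (policy_nonneg _ _ _ Hpol u ltac:(lra))
      (int_pos sq u) (exp_pos (p0 * u)); intros.
    assert (p0 <= ext sp u).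
    { unfold ext, promotion_effect; generalize (sqrt_pos (sp u)); nra. }
    enough (0 <= exp (p0 * u) * ((1 - f u) * (ext sp u - p0 + int sq u * f u))) by lra.
    apply Rmult_le_pos; [lra|apply Rmult_le_pos; [lra|nra]]. }
  exists (1 / p0); split; [apply Rdiv_lt_0_compat; lra|]; intros t Ht.
  assert (Ht' : 1 <= p0 * t).
  { apply Rmult_le_compat_l with (r := p0) in Ht; [|lra].
    replace (p0 * (1 / p0)) with 1 in Ht by (field; lra); exact Ht. }
  assert (0 < 1 / p0) by (apply Rdiv_lt_0_compat; lra).
  generalize (H t ltac:(lra)) (exp_ineq1_le (p0 * t)) (policy_lt_1 _ _ _ Hpol t); nra.
Qed.

(** Once [source] is positive, its primitive increases strictly to its supremum [c], so [L > 0].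
    Dividing the bound on [c - prim source] by [factor >= 1 - f] gives [L <= 2 W gamma disc], hence
    boundedness and decay. *)
Lemma costate_exists_infinite : 0 < theta -> unimprovable p_infty sp sq f ->
  exists L, is_costate p_infty sp sq f L /\ late p_infty (fun t => 0 < L t).
Proof.
  intros Hth Hun.
  destruct adoption_half as [a [Ha Hhalf]].
  assert (Hc : forall t, continuous f t) by apply Hpol.
  assert (Hf1 := policy_lt_1 _ _ _ Hpol).
  set (W := exp (weight sq f a) / f a).
  assert (HW : forall t, a <= t -> exp (weight sq f t) <= W).
  { intros t Ht; apply (weight_bound _ _ _ Hpol); lra. }
  assert (HW0 : 0 < W) by (generalize (HW a ltac:(lra)) (exp_pos (weight sq f a)); lra).
  clearbody W.
  assert (Hsrc : forall t, a <= t -> 0 < source t).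
  { intros t Ht; unfold source.
    generalize (factor_pos t) (disc_pos t) (proj2 (proj1 Hpol) t)
      (proj2 (proj1 (proj2 Hpol)) t) (Hhalf t Ht); intros.
    apply Rmult_lt_0_compat; [lra|apply Rmult_lt_0_compat; [lra|]].
    assert (0 <= (2 * f t - 1) * sq t) by (apply Rmult_le_pos; lra).
    assert (0 < theta * gamma) by (apply Rmult_lt_0_compat; lra); lra. }
  assert (Hmono : forall s t, a <= s < t -> prim source s < prim source t).
  { intros s t Hst; apply increasing_of_derive; [| |lra].
    - intro; apply prim_continuous, source_pc.
    - generalize (prim_derive _ source_pc); apply almost_mono; intros u Hu Hur.
      eexists; split; [exact Hu|apply Hsrc; lra]. }
  assert (Htail : forall s t, a <= s <= t ->
    prim source t - prim source s <= 2 * W * gamma * (disc s * (1 - f s))).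
  { intros s t Hst.
    (* [source] is at most [W] times the cost rate plus [theta gamma disc (1 - f)], and the latter
       is dominated by the derivative of [- gamma disc (1 - f)]. That boundary term and the bound of
       [tail_cost] are equal, whence the factor 2 in [Htail]. *)
    assert (H : W * (prim (cost_rate sp sq f) s - gamma * (disc s * (1 - f s))) - prim source s <=
                W * (prim (cost_rate sp sq f) t - gamma * (disc t * (1 - f t))) - prim source t).
    { apply (nondecreasing_of_derive (fun t =>
        W * (prim (cost_rate sp sq f) t - gamma * (disc t * (1 - f t))) - prim source t)); [| |lra].
      - generalize disc_continuous source_pc (cost_rate_pc _ _ _ Hpol); intros ? ? ? u; cont.
      - generalize (prim_derive _ source_pc) (prim_derive _ (cost_rate_pc _ _ _ Hpol))
          (policy_derive _ _ _ Hpol).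
        apply almost_mono3; intros u H1 H2 H3 Hu; generalize (disc_derive u); intro H4.
        eexists; split; [diff; reflexivity|].
        unfold source, cost_rate, factor.
        generalize (Hf1 u) (disc_pos u) (proj2 (proj1 Hpol) u)
          (proj2 (proj1 (proj2 Hpol)) u) (HW u ltac:(lra)) (exp_pos (weight sq f u))
          (policy_speed_nonneg _ _ _ Hpol u ltac:(lra)); intros.
        set (X := exp (weight sq f u)) in *; set (v := (1 - f u) * (ext sp u + _)) in *.
        clearbody X v; set (D := disc u * (1 - f u)).
        assert (HD : 0 < D) by (apply Rmult_lt_0_compat; lra).
        assert (E1 : X * (D * (sp u + (2 * f u - 1) * sq u + theta * gamma)) <=
                     X * (D * (sp u + f u * sq u + theta * gamma))).
        { apply Rmult_le_compat_l; [lra|]; apply Rmult_le_compat_l; [lra|nra]. }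
        assert (Hn : 0 <= sp u + f u * sq u + theta * gamma).
        { generalize (Hhalf u ltac:(lra)); intro.
          assert (0 <= f u * sq u) by (apply Rmult_le_pos; lra).
          assert (0 < theta * gamma) by (apply Rmult_lt_0_compat; lra); lra. }
        assert (E2 : X * (D * (sp u + f u * sq u + theta * gamma)) <=
                     W * (D * (sp u + f u * sq u + theta * gamma))).
        { apply Rmult_le_compat_r; [apply Rmult_le_pos; lra|lra]. }
        assert (E3 : 0 <= W * (gamma * (disc u * v))).
        { repeat apply Rmult_le_pos; lra. }
        unfold D in *; lra. }
    assert (Hcost := tail_cost Hun s t ltac:(lra)).
    assert (0 <= W * (gamma * (disc t * (1 - f t)))).
    { generalize (Hf1 t) (disc_pos t); intros; repeat apply Rmult_le_pos; lra. }
    apply (Rmult_le_compat_l W) in Hcost; lra. }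
  destruct (completeness (fun x => exists t, a <= t /\ x = prim source t)) as [c [Hub Hlub]].
  { exists (prim source a + 2 * W * gamma * (disc a * (1 - f a))); intros x [t [Ht ->]].
    generalize (Htail a t ltac:(lra)); lra. }
  { exists (prim source a), a; split; lra. }
  assert (Hlo : forall t, a <= t -> 0 < costate c t).
  { intros t Ht; unfold costate.
    (* Any later time would do: strict growth beyond [t] makes [prim source t < c] strict. *)
    assert (prim source (t + 1) <= c) by (apply Hub; exists (t + 1); split; [lra|auto]).
    generalize (Hmono t (t + 1) ltac:(lra)) (Rinv_0_lt_compat _ (factor_pos t)); intros.
    apply Rmult_lt_0_compat; lra. }
  assert (Hup : forall t, a <= t -> costate c t <= 2 * W * gamma * disc t).
  { intros t Ht; unfold costate.
    assert (c <= prim source t + 2 * W * gamma * (disc t * (1 - f t))).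
    { apply Hlub; intros x [u [Hu ->]].
      destruct (Rle_or_lt t u) as [H|H].
      - generalize (Htail t u ltac:(lra)); lra.
      - generalize (Hmono u t ltac:(lra)) (Hf1 t) (disc_pos t); intros.
        assert (0 <= 2 * W * gamma * (disc t * (1 - f t))) by (repeat apply Rmult_le_pos; lra).
        lra. }
    assert (Hfac : 1 - f t <= factor t).
    { unfold factor; generalize (weight_nonneg _ _ _ Hpol t ltac:(lra)) (Hf1 t)
        (exp_ineq1_le (weight sq f t)); nra. }
    apply Rmult_le_reg_r with (factor t); [apply factor_pos|].
    rewrite Rmult_assoc, Rinv_l, Rmult_1_r by (apply Rgt_not_eq, factor_pos).
    apply Rle_trans with (2 * W * gamma * disc t * (1 - f t)); [lra|].
    apply Rmult_le_compat_l; [|exact Hfac].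
    generalize (disc_pos t); intro; repeat apply Rmult_le_pos; lra. }
  exists (costate c); split; [|exists a; exact Hlo].
  split; [apply costate_continuous|split; [apply costate_derive|split]].
  - destruct (continuous_bounded (costate c) 0 a) as [M HM]; [apply costate_continuous|].
    exists (Rmax M (2 * W * gamma)); intros t [Ht _].
    destruct (Rle_or_lt t a) as [H|H].
    + apply Rle_trans with M; [apply HM; lra|apply Rmax_l].
    + apply Rle_trans with (2 * W * gamma); [|apply Rmax_r].
      generalize (Hlo t ltac:(lra)) (Hup t ltac:(lra)) (disc_le_1 t Ht) (disc_pos t); intros.
      rewrite Rabs_pos_eq by lra.
      apply Rle_trans with (2 * W * gamma * disc t); [lra|].
      rewrite <- (Rmult_1_r (2 * W * gamma)) at 2; apply Rmult_le_compat_l; [|lra].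
      repeat apply Rmult_le_pos; lra.
  - intros eps Heps.
    assert (Hk : 0 < 2 * W * gamma + gamma).
    { assert (0 < 2 * W * gamma) by (repeat apply Rmult_lt_0_compat; lra); lra. }
    destruct (disc_limit Hth (eps / (2 * W * gamma + gamma))) as [m Hm].
    { apply Rdiv_lt_0_compat; lra. }
    exists (Rmax a m); intros t Ht.
    generalize (Rmax_l a m) (Rmax_r a m); intros.
    generalize (Hlo t ltac:(lra)) (Hup t ltac:(lra)) (disc_pos t); intros.
    assert (Hd := Hm t ltac:(lra)).
    apply Rmult_le_compat_r with (r := 2 * W * gamma + gamma) in Hd; [|lra].
    replace (eps / (2 * W * gamma + gamma) * (2 * W * gamma + gamma)) with eps in Hd
      by (field; lra).
    assert (0 < gamma * disc t) by (apply Rmult_lt_0_compat; lra).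
    assert (0 < 2 * W * gamma * disc t) by (repeat apply Rmult_lt_0_compat; lra).
    apply Rabs_le; lra.
Qed.

End Costate.

Lemma continuous_Rmax_0 (g : R -> R) (t : R) :
  continuous g t -> continuous (fun s => Rmax 0 (g s)) t.
Proof.
  intros H; apply continuous_ext with (fun s => (g s + Rabs (g s)) * / 2).
  - intro s; unfold Rmax, Rabs; destruct (Rle_dec 0 (g s)), (Rcase_abs (g s)); lra.
  - assert (continuous (fun s => Rabs (g s)) t) by (apply continuous_Rabs_comp, H).
    cont; lra.
Qed.

(** Under the feedback law, [L exp (- prim k)] is nonincreasing, so positivity propagates backwards
    from the end of the horizon. *)
Lemma costate_pos (T : Rbar) (sp sq f L : R -> R) :
  Rbar_lt 0 T -> policy sp sq f -> is_costate T sp sq f L -> late T (fun t => 0 < L t) ->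
  almost (fun t => inside_horizon T t ->
    sp t = bp ^ 2 / 4 * (Rmax 0 (L t) / disc t) ^ 2 /\
    sq t = bq ^ 2 / 4 * (Rmax 0 (L t) / disc t) ^ 2) ->
  forall s, in_horizon T s -> 0 < L s.
Proof.
  intros HT Hpol [HLc [HLd _]] Hlate Hmax s Hs.
  destruct (late_exists T _ s HT Hs Hlate) as [t [Hst [HTt HLt]]].
  assert (Hc : forall t, continuous f t) by apply Hpol.
  assert (Hd : forall t, continuous (fun t => Rmax 0 (L t) * / disc t) t).
  { intro u; generalize disc_continuous (continuous_Rmax_0 L u (HLc u)); intros.
    cont; apply Rgt_not_eq, disc_pos. }
  set (h := fun t => Rmax 0 (L t) * / disc t) in *.
  set (k := fun t => ext sp t + int sq t * (2 * f t - 1)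
              - (bp ^ 2 / 4 + (2 * f t - 1) * (bq ^ 2 / 4)) * h t).
  assert (Hk : pc k).
  { generalize (ext_pc sp (proj1 Hpol)) (int_pc sq (proj1 (proj2 Hpol))); intros.
    unfold k; pcs. }
  assert (H : - (L s * exp (- prim k s)) <= - (L t * exp (- prim k t))).
  { apply (nondecreasing_of_derive (fun t => - (L t * exp (- prim k t)))); [intro; cont| |exact Hst].
    generalize (prim_derive k Hk); revert HLd Hmax; apply almost_mono3.
    intros u H1 H2 H3 Hu.
    assert (Hin : inside_horizon T u).
    { destruct Hs as [Hs _], HTt as [_ HTt]; split; [lra|].
      apply Rbar_lt_le_trans with t; [simpl; lra|exact HTt]. }
    destruct (H2 Hin) as [Ep Eq].
    exists (theta * gamma * disc u * exp (- prim k u)); split.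
    - diff; unfold k, h, Rdiv in *; rewrite Ep, Eq.
      generalize (disc_pos u); intro.
      (* This identity turns the cost terms, quadratic in [Rmax 0 L], into multiples of [L], and so
         makes the equation linear. *)
      assert (E : Rmax 0 (L u) * L u = Rmax 0 (L u) * Rmax 0 (L u)).
      { unfold Rmax; destruct Rle_dec; ring. }
      set (m := Rmax 0 (L u)) in *; set (x := exp _); clearbody m x.
      transitivity (theta * gamma * disc u * x
        + (m * m - m * L u) * / disc u * (bp ^ 2 * / 4 + (2 * f u - 1) * (bq ^ 2 * / 4)) * x);
        [field; lra|rewrite E; ring].
    - generalize (disc_pos u) (exp_pos (- prim k u)); intros.
      repeat apply Rmult_le_pos; lra. }
  generalize (exp_pos (- prim k s)) (exp_pos (- prim k t)); nra.
Qed.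

Lemma costate_exists (T : Rbar) (sp sq f : R -> R) :
  Rbar_lt 0 T -> (T = p_infty -> 0 < theta) -> policy sp sq f -> unimprovable T sp sq f ->
  exists L, is_costate T sp sq f L /\ late T (fun t => 0 < L t).
Proof.
  intros HT Hth Hpol Hun; destruct T as [b| |]; [| |easy].
  - destruct (costate_exists_finite sp sq f Hpol b HT) as [L HL]; exists L; split; [exact HL|].
    destruct HL as [_ [_ [_ Hlim]]]; simpl in *.
    generalize (disc_pos b); intro Hb.
    assert (H : 0 < gamma * disc b) by (apply Rmult_lt_0_compat; lra).
    specialize (Hlim (gamma * disc b / 2) ltac:(lra)).
    apply Rabs_le_between in Hlim; lra.
  - apply costate_exists_infinite; auto.
Qed.

Lemma optimal_feedback (T : Rbar) (sp sq f : R -> R) :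
  Rbar_lt 0 T -> (T = p_infty -> 0 < theta) -> policy sp sq f -> unimprovable T sp sq f ->
  exists L, is_costate T sp sq f L /\ (forall t, in_horizon T t -> 0 < L t) /\
    almost (fun t => inside_horizon T t ->
      sp t = bp ^ 2 / 4 * (L t / disc t) ^ 2 /\ sq t = bq ^ 2 / 4 * (L t / disc t) ^ 2).
Proof.
  intros HT Hth Hpol Hun.
  destruct (costate_exists T sp sq f HT Hth Hpol Hun) as [L [HL Hlate]].
  assert (Hmax : almost (fun t => inside_horizon T t ->
    sp t = bp ^ 2 / 4 * (Rmax 0 (L t) / disc t) ^ 2 /\
    sq t = bq ^ 2 / 4 * (Rmax 0 (L t) / disc t) ^ 2)).
  { generalize Hpol; intros [[[Csp _] Nsp] [[[Csq _] Nsq] _]].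
    revert Csp Csq; apply almost_mono2; intros t C1 C2 Ht.
    apply hamiltonian_maximizer with (f := f t); auto.
    - apply disc_pos.
    - apply (policy_pos _ _ _ Hpol), Ht.
    - intros a b Ha Hb; apply maximum_principle with (T := T); auto. }
  assert (Hpos := costate_pos T sp sq f L HT Hpol HL Hlate Hmax).
  exists L; split; [exact HL|split; [exact Hpos|]].
  revert Hmax; apply almost_mono; intros t H Ht.
  specialize (Hpos t); rewrite Rmax_right in H; [auto|].
  left; apply Hpos; destruct Ht as [H1 H2]; split; [lra|apply Rbar_lt_le, H2].
Qed.

(** * Reduction to controls defined on the whole line *)

(** Admissibility leaves the values outside the horizon arbitrary; extension by zero turns an
    admissible control into one on the whole line, possibly with new jumps at the two ends. *)
Definition restrict (T : Rbar) (s : R -> R) (t : R) : R :=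
  if excluded_middle_informative (inside_horizon T t) then s t else 0.

Lemma restrict_inside (T : Rbar) (s : R -> R) (t : R) :
  inside_horizon T t -> restrict T s t = s t.
Proof. intros H; unfold restrict; destruct excluded_middle_informative; [auto|contradiction]. Qed.

Lemma restrict_outside (T : Rbar) (s : R -> R) (t : R) :
  ~ inside_horizon T t -> restrict T s t = 0.
Proof. intros H; unfold restrict; destruct excluded_middle_informative; [contradiction|auto]. Qed.

Lemma outside_horizon_locally (T : Rbar) (t : R) :
  t < 0 \/ Rbar_lt T t -> locally t (fun s => ~ inside_horizon T s).
Proof.
  intros [H|H].
  - generalize (locally_lt 0 t H); apply filter_imp; intros s Hs [Hs' _]; lra.
  - destruct T as [b| |]; simpl in H; [|easy|].
    + generalize (locally_gt b t H); apply filter_imp; intros s Hs [_ Hs']; simpl in Hs'; lra.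
    + apply filter_forall; intros s [_ Hs]; exact Hs.
Qed.

Lemma in_horizon_locally_right (T : Rbar) (t : R) :
  0 <= t -> Rbar_lt t T -> at_right t (inside_horizon T).
Proof.
  intros H0 H; unfold at_right, within; destruct T as [b| |]; [| |easy].
  - generalize (locally_lt b t H); apply filter_imp; intros s Hs Hs'; split; simpl; lra.
  - apply filter_forall; intros s Hs; split; simpl; auto; lra.
Qed.

Lemma in_horizon_locally_left (T : Rbar) (t : R) :
  0 < t -> Rbar_le t T -> at_left t (inside_horizon T).
Proof.
  intros H0 H; unfold at_left, within; generalize (locally_gt 0 t H0); apply filter_imp.
  intros s Hs Hs'; split; [exact Hs|]; apply Rbar_lt_le_trans with t; auto.
Qed.

Lemma inside_horizon_cases (T : Rbar) (t : R) :
  t < 0 \/ Rbar_lt T t \/ t = 0 \/ Finite t = T \/ inside_horizon T t.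
Proof.
  destruct (Rtotal_order t 0) as [H|[H|H]]; auto.
  destruct (Rbar_total_order t T) as [[H1|H1]|H1]; auto.
  right; right; right; right; split; auto.
Qed.

Lemma almost_inside (T : Rbar) (P : R -> Prop) :
  almost (fun t => t < 0 \/ Rbar_lt T t \/ inside_horizon T t -> P t) -> almost P.
Proof.
  (* For an infinite horizon [real T] is the default 0, already among the exceptions. *)
  intros H; generalize (almost_neq 0) (almost_neq (real T)); revert H; apply almost_mono3.
  intros t H H0 HT; apply H.
  destruct (inside_horizon_cases T t) as [E|[E|[E|[E|E]]]]; auto; [contradiction|].
  exfalso; apply HT; rewrite <- E; reflexivity.
Qed.

Lemma control_restrict (T : Rbar) (s : R -> R) : admissible T s -> control (restrict T s).
Proof.
  intros [[[l Hl] [Hr Hf]] Hn].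
  assert (Hout : forall t, t < 0 \/ Rbar_lt T t -> locally t (fun u => 0 = restrict T s u)).
  { intros t Ht; generalize (outside_horizon_locally T t Ht); apply filter_imp.
    intros u Hu; symmetry; apply restrict_outside, Hu. }
  split; [split; [|split]|].
  - apply (almost_inside T); exists l; intros t Ht [H|[H|H]].
    + apply continuous_ext_loc with (fun _ => 0); [apply Hout; auto|apply continuous_const].
    + apply continuous_ext_loc with (fun _ => 0); [apply Hout; auto|apply continuous_const].
    + apply continuous_ext_loc with s; [|apply Hl; auto].
      generalize (inside_horizon_locally T t H); apply filter_imp.
      intros u Hu; symmetry; apply restrict_inside, Hu.
  - intro t; destruct (classic (0 <= t /\ Rbar_lt t T)) as [[H0 HT]|H].
    + destruct (Hr t H0 HT) as [r Hr']; exists r; revert Hr'; apply filterlim_ext_loc.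
      generalize (in_horizon_locally_right T t H0 HT); apply filter_imp.
      intros u Hu; symmetry; apply restrict_inside, Hu.
    + exists 0; apply filterlim_ext_loc with (fun _ => 0); [|apply filterlim_const].
      destruct (Rlt_or_le t 0) as [Ht|Ht].
      * apply filter_le_within, Hout; auto.
      * unfold at_right, within; apply filter_forall; intros u Hu.
        symmetry; apply restrict_outside; intros [_ Hu'].
        apply H; split; [exact Ht|]; apply Rbar_lt_trans with u; auto.
  - intro t; destruct (classic (0 < t /\ Rbar_le t T)) as [[H0 HT]|H].
    + destruct (Hf t H0 HT) as [r Hr']; exists r; revert Hr'; apply filterlim_ext_loc.
      generalize (in_horizon_locally_left T t H0 HT); apply filter_imp.
      intros u Hu; symmetry; apply restrict_inside, Hu.
    + exists 0; apply filterlim_ext_loc with (fun _ => 0); [|apply filterlim_const].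
      destruct (Rlt_or_le 0 t) as [Ht|Ht].
      * apply filter_le_within, Hout; right; apply Rbar_not_le_lt.
        intro HT; apply H; auto.
      * unfold at_left, within; apply filter_forall; intros u Hu.
        symmetry; apply restrict_outside; intros [Hu' _]; lra.
  - intro t; unfold restrict; destruct excluded_middle_informative as [[H1 H2]|]; [|lra].
    apply Hn; split; [lra|apply Rbar_lt_le, H2].
Qed.

Lemma control_admissible (T : Rbar) (s : R -> R) : control s -> admissible T s.
Proof.
  intros [[[l Hl] [Hr Hf]] Hn]; split; [split; [|split]|]; auto.
  exists l; auto.
Qed.

Lemma continuous_continuous_on (D : R -> Prop) (g : R -> R) :
  (forall t, continuous g t) -> continuous_on D g.
Proof.
  intros H t _; apply filterlim_filter_le_1 with (2 := H t), filter_le_within.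
Qed.

Lemma policy_adoption (T : Rbar) (sp sq f : R -> R) : policy sp sq f ->
  adoption (promotion_effect p0 bp) (promotion_effect q0 bq) T sp sq f.
Proof.
  intros [_ [_ [Hc [H0 [l Hl]]]]]; split; [apply continuous_continuous_on, Hc|].
  split; [exact H0|exists l; intros t _ Ht; exact (Hl t Ht)].
Qed.

(** A continuous retraction onto the closed horizon; composing with it turns continuity relative to
    the horizon into continuity on the line. *)
Definition clamp (T : Rbar) (t : R) : R :=
  match T with Finite b => Rmax 0 (Rmin t b) | _ => Rmax 0 t end.

Lemma clamp_in (T : Rbar) (t : R) : Rbar_lt 0 T -> in_horizon T (clamp T t).
Proof.
  intros HT; unfold in_horizon; destruct T as [b| |]; simpl in *; [| |easy].
  - split; [apply Rmax_l|apply Rmax_lub; [lra|apply Rmin_r]].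
  - split; [apply Rmax_l|exact I].
Qed.

Lemma clamp_id (T : Rbar) (t : R) : in_horizon T t -> clamp T t = t.
Proof.
  intros [H0 HT]; destruct T as [b| |]; simpl in *; [| |easy].
  - rewrite Rmin_left by lra; apply Rmax_right, H0.
  - apply Rmax_right, H0.
Qed.

Lemma clamp_continuous (T : Rbar) (t : R) : continuous (clamp T) t.
Proof.
  assert (Hid : continuous (fun s : R => s) t) by apply continuous_id.
  destruct T as [b| |]; simpl.
  - apply continuous_Rmax_0, continuous_ext with (fun s => s - Rmax 0 (s - b)).
    + intro s; unfold Rmax, Rmin; destruct (Rle_dec 0 (s - b)), (Rle_dec s b); lra.
    + assert (continuous (fun s => Rmax 0 (s - b)) t) by (apply continuous_Rmax_0; cont).
      cont.
  - apply continuous_Rmax_0, Hid.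
  - apply continuous_Rmax_0, Hid.
Qed.

Lemma clamp_comp_continuous (T : Rbar) (g : R -> R) (t : R) : Rbar_lt 0 T ->
  continuous_on (in_horizon T) g -> continuous (fun s => g (clamp T s)) t.
Proof.
  intros HT Hg.
  apply (filterlim_comp _ _ _ (clamp T) g _ (within (in_horizon T) (locally (clamp T t)))).
  - intros P HP; generalize (clamp_continuous T t _ HP).
    unfold filtermap; apply filter_imp; intros s Hs; apply Hs, clamp_in, HT.
  - apply Hg, clamp_in, HT.
Qed.

(** * Uniqueness of the state and identification of the profit *)

Lemma adoption_unique (T : Rbar) (sp sq f sp' sq' F : R -> R) :
  Rbar_lt 0 T -> policy sp' sq' F ->
  (forall t, inside_horizon T t -> sp' t = sp t /\ sq' t = sq t) ->
  adoption (promotion_effect p0 bp) (promotion_effect q0 bq) T sp sq f ->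
  forall t, in_horizon T t -> f t = F t.
Proof.
  intros HT Hpol Heq [Hf [H0 [l Hl]]] t Ht.
  (* [f] is only continuous relative to the horizon, so it is frozen outside. *)
  set (fc := fun s => f (clamp T s)).
  assert (Hfc : forall s, continuous fc s) by (intro; apply clamp_comp_continuous; auto).
  assert (HF : forall s, continuous F s) by apply Hpol.
  assert (Hd : almost (fun s => inside_horizon T s ->
    is_derive fc s ((1 - fc s) * (ext sp' s + int sq' s * fc s)))).
  { exists l; intros s Hs Hin.
    assert (Hloc : locally s (fun u => f u = fc u)).
    { generalize (inside_horizon_locally T s Hin); apply filter_imp; intros u [H1 H2].
      unfold fc; rewrite clamp_id; [auto|split; [lra|apply Rbar_lt_le, H2]]. }
    apply is_derive_ext_loc with f; [exact Hloc|].
    destruct (Heq s Hin) as [Ep Eq]; unfold ext, int; rewrite Ep, Eq.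
    rewrite <- (locally_singleton _ _ Hloc); exact (Hl s Hin Hs). }
  (* [k] is the cofactor of [fc - F] in the difference of the two Riccati right-hand sides, so the
     difference of the solutions solves a homogeneous linear equation. *)
  set (k := fun s => int sq' s * (1 - fc s) - (ext sp' s + int sq' s * F s)).
  assert (Hk : pc k).
  { generalize (ext_pc sp' (proj1 Hpol)) (int_pc sq' (proj1 (proj2 Hpol))); intros.
    unfold k; pcs. }
  assert (E : (fc 0 - F 0) * exp (- prim k 0) = (fc t - F t) * exp (- prim k t)).
  { apply (linear_ode (fun s => fc s - F s) k); [intro; cont|exact Hk| |apply Ht].
    generalize (policy_derive _ _ _ Hpol); revert Hd; apply almost_mono2.
    intros s H1 H2 Hs.
    assert (Hin : inside_horizon T s).
    { destruct Ht as [_ Ht]; split; [lra|].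
      apply Rbar_lt_le_trans with t; [simpl; lra|exact Ht]. }
    specialize (H1 Hin); diff; unfold k; ring. }
  assert (E0 : fc 0 = 0).
  { unfold fc; rewrite clamp_id; [exact H0|split; [lra|apply Rbar_lt_le, HT]]. }
  assert (EF : F 0 = 0) by apply Hpol.
  assert (Et : fc t = f t) by (unfold fc; rewrite clamp_id; auto).
  rewrite E0, EF, Et in E.
  generalize (exp_pos (- prim k t)); intro.
  assert (E' : (f t - F t) * exp (- prim k t) = 0) by (rewrite <- E; ring).
  apply Rmult_integral in E'; destruct E'; lra.
Qed.

(** [Lim] at [p_infty] unfolds to [Lim_seq] along the integers, hence this form. *)
Definition total_gain (T : Rbar) (sp sq f : R -> R) : Rbar :=
  match T with
  | Finite b => Finite (gain sp sq f b)
  | _ => Lim_seq (fun n => gain sp sq f (INR n))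
  end.

Lemma profit_total_gain (T : Rbar) (sp sq f sp' sq' F : R -> R) :
  Rbar_lt 0 T -> policy sp' sq' F ->
  (forall t, inside_horizon T t -> sp' t = sp t /\ sq' t = sq t) ->
  adoption (promotion_effect p0 bp) (promotion_effect q0 bq) T sp sq f ->
  profit theta gamma T sp sq f = total_gain T sp' sq' F.
Proof.
  intros HT Hpol Heq Had.
  assert (EF := adoption_unique T sp sq f sp' sq' F HT Hpol Heq Had).
  assert (H : forall t, 0 < t -> in_horizon T t ->
    RInt (profit_rate theta gamma sp sq f) 0 t = gain sp' sq' F t).
  { intros t H0 Ht.
    assert (Hin : forall u, 0 < u < t -> inside_horizon T u).
    { intros u Hu; destruct Ht as [_ Ht]; split; [lra|].
      apply Rbar_lt_le_trans with t; [simpl; lra|exact Ht]. }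
    apply RInt_of_derive with (fun t =>
      disc t * ((1 - F t) * (gamma * (ext sp' t + int sq' t * F t) - (sp' t + F t * sq' t)))).
    - intro; apply gain_continuous, Hpol.
    - apply gain_0.
    - assert (HF : forall s, continuous F s) by apply Hpol.
      generalize (ext_pc sp' (proj1 Hpol)) (int_pc sq' (proj1 (proj2 Hpol))) disc_continuous.
      destruct Hpol as [[? _] [[? _] _]]; intros; pcs.
    - exact H0.
    - generalize (gain_derive _ _ _ Hpol); apply almost_mono; auto.
    - destruct Had as [_ [_ [l Hl]]]; exists l; intros u Hu Hur.
      assert (Hiu := Hin u Hur).
      unfold profit_rate; rewrite (is_derive_unique _ _ _ (Hl u Hiu Hu)).
      destruct (Heq u Hiu) as [Ep Eq]; unfold adoption_speed, ext, int; rewrite Ep, Eq.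
      rewrite (EF u) by (destruct Hiu as [H1 H2]; split; [lra|apply Rbar_lt_le, H2]).
      unfold disc; ring. }
  destruct T as [b| |]; [| |easy]; simpl in *.
  - f_equal; apply H; [exact HT|split; simpl; lra].
  - apply Lim_seq_ext_loc; exists 1%nat; intros n Hn.
    apply H; [apply lt_0_INR; auto with arith|split; [apply pos_INR|exact I]].
Qed.

(** On an infinite horizon, a fixed lead contradicts optimality only if the optimal limit is finite.
    Revenue converges, being monotone and bounded by [gamma]; infinite cost is excluded by
    comparison with no promotion, whose gain is nonnegative. *)
Lemma optimal_unimprovable (T : Rbar) (sp sq F : R -> R) :
  Rbar_lt 0 T -> policy sp sq F ->
  (forall sp' sq' f', policy sp' sq' f' ->
     Rbar_le (total_gain T sp' sq' f') (total_gain T sp sq F)) ->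
  unimprovable T sp sq F.
Proof.
  intros HT Hpol Hopt sp' sq' f' kappa Hpol' Hk Hlate.
  assert (H := Hopt sp' sq' f' Hpol').
  destruct T as [b| |]; [simpl in *; lra| |easy].
  destruct (policy_exists (fun _ => 0) (fun _ => 0)) as [f0 Hpol0];
    [apply control_const; lra|apply control_const; lra|].
  assert (H0 := Hopt _ _ _ Hpol0); simpl in *.
  assert (Hg0 : Rbar_le 0 (Lim_seq (fun n => gain (fun _ => 0) (fun _ => 0) f0 (INR n)))).
  { rewrite <- (Lim_seq_const 0); apply Lim_seq_le_loc; exists 0%nat; intros n _.
    assert (Hn := pos_INR n).
    assert (Hcost : prim (cost_rate (fun _ => 0) (fun _ => 0) f0) 0 =
                    prim (cost_rate (fun _ => 0) (fun _ => 0) f0) (INR n)).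
    { apply constant_of_derive; [| |exact Hn].
      - intro; apply prim_continuous, cost_rate_pc, Hpol0.
      - generalize (prim_derive _ (cost_rate_pc _ _ _ Hpol0)); apply almost_mono.
        intros v Hv _; apply (derive_value _ _ _ _ Hv); unfold cost_rate; ring. }
    generalize (revenue_bounds _ _ _ Hpol0 0 (INR n) ltac:(lra)).
    unfold gain; rewrite <- Hcost, !prim_0; lra. }
  set (u := fun n => gain sp sq F (INR n)) in *.
  set (c := fun n => prim (cost_rate sp sq F) (INR n)).
  set (r := fun n => prim (revenue_rate sp sq F) (INR n)).
  assert (Hle : forall n : nat, 0 <= INR n <= INR (S n)).
  { intro n; rewrite S_INR; generalize (pos_INR n); lra. }
  assert (Hr : ex_finite_lim_seq r).
  { apply ex_finite_lim_seq_incr with gamma; intro n; unfold r.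
    - generalize (revenue_bounds _ _ _ Hpol _ _ (Hle n)); lra.
    - generalize (revenue_bounds _ _ _ Hpol 0 (INR n) ltac:(generalize (pos_INR n); lra)).
      assert (E0 : F 0 = 0) by apply Hpol; generalize (policy_lt_1 _ _ _ Hpol (INR n)).
      rewrite prim_0, E0; unfold disc; rewrite Rmult_0_r, exp_0; nra. }
  assert (Hc : ex_lim_seq c).
  { apply ex_lim_seq_incr; intro n; apply (cost_mono _ _ _ Hpol), Hle. }
  destruct Hr as [lr Hr], Hc as [lc Hc].
  assert (Hu : is_lim_seq u (Rbar_minus lr lc)).
  { apply is_lim_seq_minus with (Finite lr) lc; [exact Hr|exact Hc|].
    apply Rbar_plus_correct; destruct lc; exact I. }
  rewrite (is_lim_seq_unique _ _ Hu) in *.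
  assert (Hlc : Rbar_le 0 lc).
  { apply is_lim_seq_le with (fun _ => 0) c; [|apply is_lim_seq_const|exact Hc].
    intro n; unfold c; rewrite <- (prim_0 (cost_rate sp sq F)).
    apply (cost_mono _ _ _ Hpol); generalize (pos_INR n); lra. }
  destruct lc as [lc| |]; simpl in *; [| |easy].
  - assert (Hu' : is_lim_seq (fun n => u n + kappa) (Finite (lr + - lc + kappa))).
    { apply is_lim_seq_plus with (Finite (lr + - lc)) (Finite kappa);
        [exact Hu|apply is_lim_seq_const|reflexivity]. }
    assert (Rbar_le (lr + - lc + kappa) (lr + - lc)).
    { apply Rbar_le_trans with (2 := H); rewrite <- (is_lim_seq_unique _ _ Hu').
      apply Lim_seq_le_loc; destruct Hlate as [a Ha].
      destruct (INR_unbounded a) as [N HN]; exists N; intros n Hn; apply Ha.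
      apply le_INR in Hn; lra. }
    simpl in *; lra.
  - exact (Rbar_le_trans (Finite 0) _ m_infty Hg0 H0).
Qed.

(** Near an inside time, [F] differs from the primitive of the continuous [g] by a constant. This
    upgrades equations valid off a finite set to classical ones. *)
Lemma derive_everywhere (T : Rbar) (F g : R -> R) :
  (forall t, continuous F t) -> (forall t, continuous g t) ->
  almost (fun t => inside_horizon T t -> is_derive F t (g t)) ->
  forall t, inside_horizon T t -> is_derive F t (g t).
Proof.
  intros HF Hg Hd t Ht.
  assert (Hpg : pc g) by (apply pc_continuous, Hg).
  apply is_derive_ext_loc with (fun s => prim g s + F 0).
  - generalize (inside_horizon_locally T t Ht); apply filter_imp; intros s [Hs0 HsT].
    enough (F 0 - prim g 0 = F s - prim g s) by (rewrite prim_0 in *; lra).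
    apply (constant_of_derive (fun s => F s - prim g s)); [intro; cont| |lra].
    generalize (prim_derive g Hpg); revert Hd; apply almost_mono2; intros u H1 H2 Hu.
    assert (Hin : inside_horizon T u).
    { split; [lra|]; apply Rbar_lt_trans with s; [simpl; lra|exact HsT]. }
    specialize (H1 Hin); diff; ring.
  - generalize (prim_derive_at g t Hpg (Hg t)); intro H; diff; ring.
Qed.

End Promotion.

(** * The boundary-value problem for the optimal policy *)

Theorem theorem9
  (p0 q0 bp bq gamma theta : R) (T : Rbar)
  (Hp0 : 0 < p0) (Hq0 : 0 < q0) (Hbp : 0 < bp) (Hbq : 0 < bq)
  (Hgamma : 0 < gamma) (Htheta : 0 <= theta)
  (HT : Rbar_lt (Finite 0) T) (HTtheta : T = p_infty -> 0 < theta)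
  (sp_opt sq_opt : R -> R)
  (Hopt : optimal_policy (promotion_effect p0 bp) (promotion_effect q0 bq)
            theta gamma T sp_opt sq_opt) :
  exists f Psi : R -> R,
    let sp := fun t => bp ^ 2 / 4 * (Psi t * exp (theta * t) + gamma) ^ 2 in
    let sq := fun t => bq ^ 2 / bp ^ 2 * sp t in
    equal_up_to_finite T sp_opt sp /\
    equal_up_to_finite T sq_opt sq /\
    boundary_value_problem (promotion_effect p0 bp) (promotion_effect q0 bq)
      theta gamma T sp sq f Psi.
Proof.
  destruct Hopt as [Hap [Haq [f0 [Hf0 Hbest]]]].
  set (spr := restrict T sp_opt); set (sqr := restrict T sq_opt).
  destruct (policy_exists p0 q0 bp bq Hp0 Hq0 Hbp Hbq spr sqr) as [f Hpol];
    [apply control_restrict, Hap|apply control_restrict, Haq|].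
  assert (Heq : forall t, inside_horizon T t -> spr t = sp_opt t /\ sqr t = sq_opt t).
  { intros t Ht; split; apply restrict_inside, Ht. }
  assert (Hun : unimprovable p0 q0 bp bq gamma theta T spr sqr f).
  { apply optimal_unimprovable; auto; intros sp' sq' f' Hpol'.
    assert (Had := policy_adoption p0 q0 bp bq T sp' sq' f' Hpol').
    rewrite <- (profit_total_gain p0 q0 bp bq gamma theta) with (sp := sp') (sq := sq') (f := f') by auto.
    rewrite <- (profit_total_gain p0 q0 bp bq gamma theta) with (sp := sp_opt) (sq := sq_opt) (f := f0) by auto.
    apply Hbest; auto; apply control_admissible, Hpol'. }
  destruct (optimal_feedback p0 q0 bp bq gamma theta Hp0 Hq0 Hbp Hbq Hgamma Htheta
              T spr sqr f HT HTtheta Hpol Hun) as [L [[HLc [HLd [_ HLT]]] [HLpos Hfb]]].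
  set (Psi := fun t => L t - gamma * disc theta t).
  set (lam := fun t => Psi t * exp (theta * t) + gamma).
  (* The bracket of the stated formula is the current-value multiplier, which is what the feedback
     law contains. *)
  assert (Hlam : forall t, lam t = L t / disc theta t).
  { intro t; unfold lam, Psi, disc.
    replace (- theta * t) with (- (theta * t)) by ring; rewrite exp_Ropp.
    field; apply Rgt_not_eq, exp_pos. }
  exists f, Psi; intros sp sq.
  assert (Esq : forall t, sq t = bq ^ 2 / 4 * lam t ^ 2) by (intro; unfold sq, sp, lam; field; lra).
  assert (Hc : forall t, continuous f t) by apply Hpol.
  assert (HPsi : forall t, continuous Psi t).
  { intro t; unfold Psi; cont; apply disc_continuous. }
  assert (Hsp : forall t, continuous sp t).
  { intro t; unfold sp; simpl; cont. }
  assert (Hsq : forall t, continuous sq t) by (intro; unfold sq; cont).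
  assert (Hagree : almost (fun t => inside_horizon T t -> spr t = sp t /\ sqr t = sq t)).
  { revert Hfb; apply almost_mono; intros t H Ht; destruct (H Ht) as [-> ->].
    rewrite <- Hlam, Esq; auto. }
  assert (Hhor : almost (fun t => in_horizon T t -> inside_horizon T t)).
  (* The ends of the horizon join the exceptions, since the feedback law is known only inside. *)
  { apply (almost_inside T); exists nil; intros t _ H [H0 H1].
    destruct H as [H|[H|H]]; [lra| |exact H].
    exfalso; exact (Rbar_le_not_lt _ _ H1 H). }
  assert (Hexc : almost (fun t => in_horizon T t -> sp_opt t = sp t /\ sq_opt t = sq t)).
  { revert Hagree Hhor; apply almost_mono2; intros t H1 H2 Ht.
    destruct (Heq t (H2 Ht)) as [<- <-]; auto. }
  destruct Hexc as [l Hl].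
  split; [exists l; intros t Ht Hn; apply (Hl t Hn Ht)|].
  split; [exists l; intros t Ht Hn; apply (Hl t Hn Ht)|].
  split; [apply continuous_continuous_on, Hc|].
  split; [apply continuous_continuous_on, HPsi|].
  split; [|split; [apply Hpol|split]].
  - apply (derive_everywhere T f (adoption_speed (promotion_effect p0 bp)
             (promotion_effect q0 bq) sp sq f)).
    + exact Hc.
    + intro; unfold adoption_speed, promotion_effect; cont.
    + revert Hagree; generalize (policy_derive _ _ _ _ _ _ _ Hpol); apply almost_mono2.
      intros t H1 H2 Ht; destruct (H2 Ht) as [E1 E2].
      unfold adoption_speed; rewrite <- E1, <- E2; exact H1.
  - apply (derive_everywhere T Psi (costate_speed (promotion_effect p0 bp)
             (promotion_effect q0 bq) theta gamma sp sq f Psi)).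
    + exact HPsi.
    + intro; unfold costate_speed, promotion_effect; cont.
    + revert HLd Hagree; apply almost_mono2; intros t H1 H2 Ht; destruct (H2 Ht) as [E1 E2].
      generalize (disc_derive theta t); intro H3.
      unfold costate_speed; rewrite <- E1, <- E2; unfold Psi; diff.
      unfold ext, int, disc; ring.
  - unfold vanishes_at_horizon; destruct T as [b| |]; [| |easy].
    + apply Rabs_eq_0, Rle_antisym; [|apply Rabs_pos].
      apply le_epsilon; intros eps Heps; rewrite Rplus_0_l; exact (HLT eps Heps).
    (* Half of [eps], because the limit asks for a strict inequality. *)
    + apply is_lim_spec; intro eps; destruct (HLT (eps / 2)) as [a Ha].
      { generalize (cond_pos eps); lra. }
      exists a; intros t Ht; rewrite Rminus_0_r.
      generalize (Ha t ltac:(lra)) (cond_pos eps); unfold Psi; lra.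
Qed.
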